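(* Let $K\subset\mathbb C$ be a compact set with empty interior. Then for each $\varepsilon>0$ there exists a compact set $L\subset \mathbb C$ with $L\supset K$ such that the Hausdorff dimension of $L\setminus K$ is at most $1+\varepsilon$ and the following holds: there exists a homeomorphism $f\colon\mathbb C\to\mathbb C$ that is conformal on $\mathbb C\setminus L$ such that $f(L)$ has Hausdorff dimension at most $1+\varepsilon$ and in particular $f(L)$ has Lebesgue measure zero.
   Context: Interior, Hausdorff dimension and (two-dimensional) Lebesgue measure are taken in the plane $\mathbb C$. *)

(* Defs.v *)
From mathcomp Require Import all_boot all_order all_algebra.
From mathcomp Require Export complex.
From mathcomp Require Import all_classical all_reals all_analysis.
Export numFieldNormedType.Exports.

Set Implicit Arguments.
Unset Strict Implicit.
Unset Printing Implicit Defensive.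

Import Order.TTheory GRing.Theory Num.Theory.
Local Open Scope classical_set_scope.
Local Open Scope ring_scope.

(* The regular module [R[i]^o] is used rather than [R[i]] because it is the
   former that carries the topology and the normed structure over [R[i]]. *)
Notation cplane R := (complex R)^o%type.

(* The [maxe 0] gives the empty set diameter 0 (a bare supremum would give
   [-oo]). *)
Definition diam (R : realType) (U : set (cplane R)) : \bar R :=
  maxe 0%E (ereal_sup [set e | exists x y : cplane R,
    [/\ U x, U y & e = (Normc.normc (x - y))%:E]]).

Definition hausdorff_premeasure (R : realType) (s d : R)
    (A : set (cplane R)) : \bar R :=
  ereal_inf [set e | exists U : nat -> set (cplane R),
    [/\ A `<=` \bigcup_n U n,
        (forall n, diam (U n) <= d%:E)%E &
        (e = \sum_(0 <= n <oo) (diam (U n) `^ s))%E]].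

Definition hausdorff_measure (R : realType) (s : R)
    (A : set (cplane R)) : \bar R :=
  ereal_sup [set e | exists2 d : R, 0 < d & e = hausdorff_premeasure s d A].

(* Only [0 < s] is allowed: at [s = 0] the convention [0 `^ 0 = 1] would count
   the empty sets of a cover. The infimum is unaffected, and the empty set
   has dimension 0. *)
Definition hausdorff_dim (R : realType) (A : set (cplane R)) : \bar R :=
  ereal_inf [set e | exists s : R,
    [/\ 0 < s, hausdorff_measure s A = 0%E & e = s%:E]].

Definition area (R : realType) (A : set (cplane R)) : \bar R :=
  (lebesgue_measure \x lebesgue_measure)%E
    [set (complex.Re z, complex.Im z) | z in A].

Definition homeomorphism (X Y : topologicalType) (f : X -> Y) : Prop :=
  continuous f /\
  exists g : Y -> X, [/\ cancel f g, cancel g f & continuous g].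

(* [derivable f z 1] is complex differentiability at [z], since the scalars
   are [R[i]]. *)
Definition conformal_on (R : realType) (U : set (cplane R))
    (f : cplane R -> cplane R) : Prop :=
  [/\ open U, {in U &, injective f} &
      forall z, U z -> derivable f z 1].

(* Main.v *)
Require Import Defs.
From mathcomp Require Import all_boot all_order all_algebra.
From mathcomp Require Import all_classical all_reals all_analysis.
From mathcomp Require Import ring lra.

(* Idea. The homeomorphism is a uniform limit of piecewise linear
   homeomorphisms f_n of the plane that are the identity outside a square and
   similarities on a finite, growing family of disjoint closed rectangles; L is
   what remains of the square when the interiors of all source rectangles are
   removed. To fill the range at stage n, subdivide the square by a fine grid
   containing the sides of the present image rectangles. In each live cell c
   choose a point outside f_n(K) near which the inverse of f_n is affine (such
   points are dense, because K has empty interior); a homeomorphism supported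
   in c moves it to the centre, corrects the linear part by shears and blows a
   tiny neighbourhood up, so that f_{n+1} maps a tiny rectangle disjoint from K
   by a similarity onto c shrunk by a factor 1 - delta. The remaining part of the
   range lies in a thin neighbourhood of finitely many lines, hence has small
   (1 + eps)-dimensional size. Fill the domain alternately in the same way, with
   the roles of f_n and its inverse exchanged, using only the cells disjoint from
   K: what remains at a positive distance from K is then small as well. *)

Set Implicit Arguments.
Unset Strict Implicit.

Import Order.TTheory GRing.Theory Num.Theory.
Local Open Scope classical_set_scope.
Local Open Scope ring_scope.

(** * Piecewise linear homeomorphisms of the plane *)

Section Plane.
Context {R : realType}.
Notation pt := (R * R)%type.
Implicit Types (p q : pt) (f g h : pt -> pt) (u v : pt -> R).

(** Filling the range alone controls nothing in the domain, since the source rectangles are tiny;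
    hence the alternation. Domain cells near [K] can never be filled, as [K] must stay in [L], so
    the domain bound holds only away from [K]. No Lipschitz bound is uniform in n. A stage moves
    images only within grid cells, and its mesh is chosen after the Lipschitz constant of the
    current inverse, so that the inverse also moves little; thus maps and inverses both converge
    uniformly and the limit is a homeomorphism. Rectangles already placed are never disturbed: a
    cell whose interior meets one is skipped, and loses nothing, because the sides lie on grid lines
    and so the cell lies inside the rectangle. The limit is therefore the same similarity there.
    Linear parts have positive determinant, so row operations bring them to a positive diagonal; the
    similarities have positive real ratio and no rotation, which keeps all sides parallel to the
    axes. Covering lines of finite total length by balls of radius r costs about r^(s-1), which
    tends to 0 because s > 1. *)

Definition dist1 p q : R := `|p.1 - q.1| + `|p.2 - q.2|.

Lemma dist1_ge0 p q : 0 <= dist1 p q.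
Proof. by rewrite addr_ge0. Qed.

Lemma dist1xx p : dist1 p p = 0.
Proof. by rewrite /dist1 !subrr normr0 addr0. Qed.

Lemma dist1C p q : dist1 p q = dist1 q p.
Proof. by rewrite /dist1 distrC [X in _ + X]distrC. Qed.

Lemma dist1_triangle q p p' : dist1 p p' <= dist1 p q + dist1 q p'.
Proof.
have := ler_distD q.1 p.1 p'.1; have := ler_distD q.2 p.2 p'.2.
rewrite /dist1; lra.
Qed.

Lemma dist1_eq0 p q : dist1 p q = 0 -> p = q.
Proof.
case: p q => [a b] [c d] /eqP; rewrite paddr_eq0 //= !normr_eq0 !subr_eq0.
by case/andP => /eqP -> /eqP ->.
Qed.

Lemma dist1_lt_proj p q r :
  dist1 p q < r -> `|q.1 - p.1| < r /\ `|q.2 - p.2| < r.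
Proof.
rewrite /dist1 distrC [X in _ + X]distrC => h.
have := normr_ge0 (q.1 - p.1); have := normr_ge0 (q.2 - p.2).
by split; lra.
Qed.

Definition lipschitz1 f := exists2 C : R, 0 < C &
  forall p q, dist1 (f p) (f q) <= C * dist1 p q.

Definition lipschitzR u := exists2 C : R, 0 < C &
  forall p q, `|u p - u q| <= C * dist1 p q.

(** Density of an open condition, with the radius recorded: finitely many such conditions, if stable
    under passing to smaller balls, can be met at once. *)
Definition dense_balls (P : pt -> R -> Prop) := forall p (r : R), 0 < r ->
  exists p' r', [/\ 0 < r', dist1 p p' + r' <= r & P p' r'].

Definition hereditary (P : pt -> R -> Prop) := forall p r p' r',
  dist1 p p' + r' <= r -> P p r -> P p' r'.

Lemma dense_ballsI (P Q : pt -> R -> Prop) : hereditary P ->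
  dense_balls P -> dense_balls Q -> dense_balls (fun p r => P p r /\ Q p r).
Proof.
move=> hP dP dQ p r r0.
have [p1 [r1 [r10 le1 P1]]] := dP p r r0.
have [p2 [r2 [r20 le2 Q2]]] := dQ p1 r1 r10.
exists p2, r2; split => //; last by split => //; exact: hP P1.
by have := dist1_triangle p1 p p2; lra.
Qed.

Definition affineR_on u p (r : R) := exists a b : R, forall q, dist1 p q < r ->
  u q = u p + a * (q.1 - p.1) + b * (q.2 - p.2).

(** The positive determinant survives composition and inversion, and later lets row operations with
    positive factors reach a positive diagonal matrix. *)
Definition affine_on f p (r : R) := exists a b c d : R,
  0 < a * d - b * c /\ forall q, dist1 p q < r ->
  f q = ((f p).1 + a * (q.1 - p.1) + b * (q.2 - p.2),
         (f p).2 + c * (q.1 - p.1) + d * (q.2 - p.2)).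

Lemma affineR_on_hereditary u : hereditary (affineR_on u).
Proof.
move=> p r p' r' le [a [b E]]; exists a, b => q hq.
rewrite E; last by have := dist1_triangle p' p q; lra.
rewrite (E p'); last by have := dist1_ge0 p' q; lra.
by ring.
Qed.

Lemma affine_on_hereditary f : hereditary (affine_on f).
Proof.
move=> p r p' r' le [a [b [c [d [det E]]]]]; exists a, b, c, d.
split=> // q hq.
rewrite E; last by have := dist1_triangle p' p q; lra.
rewrite (E p') /=; last by have := dist1_ge0 p' q; lra.
by congr (_, _); ring.
Qed.

(* Piecewise linear functions, in the weak sense that suffices here: Lipschitz,
   and affine on some ball inside every ball. *)
Definition plR u := lipschitzR u /\ dense_balls (affineR_on u).

Lemma plR_affine (a b c : R) : plR (fun p => a * p.1 + b * p.2 + c).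
Proof.
split.
  exists (`|a| + `|b| + 1); first by have := normr_ge0 a; have := normr_ge0 b; lra.
  move=> p q.
  have -> : a * p.1 + b * p.2 + c - (a * q.1 + b * q.2 + c) =
    a * (p.1 - q.1) + b * (p.2 - q.2) by ring.
  apply: le_trans (ler_normD _ _) _; rewrite !normrM /dist1.
  have := normr_ge0 a; have := normr_ge0 b.
  have := normr_ge0 (p.1 - q.1); have := normr_ge0 (p.2 - q.2).
  move: `|_| `|_| `|a| `|b| => x y A B.
  by nra.
move=> p r r0; exists p, r; rewrite dist1xx add0r; split=> //.
by exists a, b => q _; ring.
Qed.

Lemma plR_opp u : plR u -> plR (fun p => - u p).
Proof.
move=> [[C C0 hC] du]; split.
  exists C => // p q; rewrite -opprD normrN; exact: hC.
move=> p r r0; have [p' [r' [r'0 le [a [b E]]]]] := du p r r0.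
exists p', r'; split=> //; exists (- a), (- b) => q hq; rewrite E //; ring.
Qed.

Lemma plR_add u v : plR u -> plR v -> plR (fun p => u p + v p).
Proof.
move=> [[C C0 hC] du] [[C' C'0 hC'] dv]; split.
  exists (C + C') => [|p q]; first lra.
  rewrite mulrDl opprD addrACA; apply: le_trans (ler_normD _ _) _.
  exact: lerD.
move=> p r r0.
have [p' [r' [r'0 le [[a [b E]] [a' [b' E']]]]]] :=
  dense_ballsI (affineR_on_hereditary (u:=u)) du dv p r0.
exists p', r'; split=> //; exists (a + a'), (b + b') => q hq.
rewrite E // E' //; ring.
Qed.

Lemma plR_scale (k : R) u : plR u -> plR (fun p => k * u p).
Proof.
move=> [[C C0 hC] du]; split.
  exists ((`|k| + 1) * C) => [|p q].
    by apply: mulr_gt0 => //; have := normr_ge0 k; lra.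
  rewrite -mulrBr normrM -mulrA.
  apply: ler_pM => //; have := normr_ge0 k; lra.
move=> p r r0; have [p' [r' [r'0 le [a [b E]]]]] := du p r r0.
exists p', r'; split=> //; exists (k * a), (k * b) => q hq; rewrite E //; ring.
Qed.

Lemma lipschitzR_gt_ball u v q (r : R) : lipschitzR u -> lipschitzR v -> 0 < r ->
  u q < v q ->
  exists r', [/\ 0 < r', r' <= r & forall z, dist1 q z < r' -> u z < v z].
Proof.
move=> [C C0 hC] [C' C'0 hC'] r0 lt.
have pos : 0 < (v q - u q) / (C + C') by apply: divr_gt0; lra.
exists (Num.min r ((v q - u q) / (C + C'))); split.
- by rewrite lt_min r0.
- by rewrite ge_min lexx.
move=> z; rewrite lt_min => /andP [_]; rewrite ltr_pdivlMr; last lra.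
have := hC q z; have := hC' q z; rewrite !ler_norml => /andP [? ?] /andP [? ?].
by nra.
Qed.

(** The linear pieces need no description. In a ball where both functions are affine, either [v < u]
    at some point, hence on a smaller ball, or [u <= v] throughout. *)
Lemma plR_max u v : plR u -> plR v -> plR (fun p => Num.max (u p) (v p)).
Proof.
move=> [lu du] [lv dv]; split.
  case: lu lv => [C C0 hC] [C' C'0 hC'].
  exists (C + C') => [|p q]; first lra.
  have := hC p q; have := hC' p q; rewrite !ler_norml.
  have d0 := dist1_ge0 p q; move: (dist1 p q) d0 => d d0.
  have : 0 <= C * d by rewrite mulr_ge0 // ltW.
  have : 0 <= C' * d by rewrite mulr_ge0 // ltW.
  rewrite mulrDl; move: (C * d) (C' * d) => a b b0 a0 /andP [? ?] /andP [? ?].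
  by case: (leP (u p) (v p)); case: (leP (u q) (v q)) => *;
    apply/andP; split; lra.
move=> p r r0.
have [p' [r' [r'0 le [Au Av]]]] :=
  dense_ballsI (affineR_on_hereditary (u:=u)) du dv p r0.
have [[q [hq lt]]|no] := pselect (exists q, dist1 p' q < r' /\ v q < u q).
  have [|r2 [r20 r2le gt]] := @lipschitzR_gt_ball v u q (r' - dist1 p' q) lv lu _ lt.
    lra.
  exists q, r2; split=> //.
    by have := dist1_triangle p' p q; lra.
  have [a [b E]] : affineR_on u q r2 by apply: (affineR_on_hereditary _ Au); lra.
  exists a, b => z hz.
  have hq2 : dist1 q q < r2 by rewrite dist1xx.
  by rewrite (max_l (ltW (gt _ hz))) (max_l (ltW (gt _ hq2))) E.
exists p', r'; split=> //; case: Av => a [b E]; exists a, b => z hz.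
have le_uv y : dist1 p' y < r' -> u y <= v y.
  by move=> hy; rewrite leNgt; apply/negP => lt; apply: no; exists y.
have hp' : dist1 p' p' < r' by rewrite dist1xx.
by rewrite (max_r (le_uv _ hz)) (max_r (le_uv _ hp')) E.
Qed.

Lemma plR_min u v : plR u -> plR v -> plR (fun p => Num.min (u p) (v p)).
Proof.
move=> pu pv.
have -> : (fun p => Num.min (u p) (v p)) = (fun p => - Num.max (- u p) (- v p)).
  by apply/funext => p; rewrite oppr_max !opprK.
by apply/plR_opp/plR_max; exact: plR_opp.
Qed.

Definition pl_homeo f g :=
  [/\ cancel f g, cancel g f, lipschitz1 f, lipschitz1 g &
      dense_balls (affine_on f)].

Lemma lipschitz1_comp f h : lipschitz1 f -> lipschitz1 h -> lipschitz1 (h \o f).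
Proof.
move=> [C C0 hC] [C' C'0 hC']; exists (C' * C); first exact: mulr_gt0.
move=> p q /=; apply: le_trans (hC' _ _) _.
by rewrite -mulrA ler_pM2l.
Qed.

Lemma lipschitz1_image_ball f g p (r : R) : cancel f g -> cancel g f ->
  lipschitz1 g -> 0 < r ->
  exists2 r', 0 < r' & forall y, dist1 (f p) y < r' -> dist1 p (g y) < r.
Proof.
move=> fg gf [C C0 hC] r0; exists (r / C); first exact: divr_gt0.
move=> y; rewrite ltr_pdivlMr // => h.
by have := hC (f p) y; rewrite fg; nra.
Qed.

(** A ball on which [f] is affine has an image containing a ball, because [g] is Lipschitz; inside
    that one [h] is affine on some ball, which is pulled back using that [f] is Lipschitz. *)
Lemma dense_affine_comp f g h : pl_homeo f g -> dense_balls (affine_on h) ->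
  dense_balls (affine_on (h \o f)).
Proof.
move=> [fg gf Lf Lg df] dh p r r0.
have [p1 [r1 [r10 le1 A1]]] := df p r r0.
have [s s0 hs] := @lipschitz1_image_ball f g p1 r1 fg gf Lg r10.
have [y2 [r2 [r20 le2 A2]]] := dh (f p1) s s0.
pose p2 := g y2.
have p2in : dist1 p1 p2 < r1 by apply: hs; lra.
case: Lf => C C0 hC.
pose r3 := Num.min (r1 - dist1 p1 p2) (r2 / C).
have r30 : 0 < r3 by rewrite lt_min divr_gt0 //; lra.
have [r3a r3b] : r3 <= r1 - dist1 p1 p2 /\ r3 <= r2 / C.
  by split; rewrite ge_min lexx ?orbT.
exists p2, r3; split=> //.
  by have := dist1_triangle p1 p p2; lra.
have [a [b [c [d [det E]]]]] : affine_on f p2 r3.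
  by apply: (affine_on_hereditary _ A1); lra.
have fp2 : f p2 = y2 by rewrite /p2 gf.
case: A2 => [a' [b' [c' [d' [det' E']]]]].
exists (a' * a + b' * c), (a' * b + b' * d), (c' * a + d' * c), (c' * b + d' * d).
split.
  have -> : (a' * a + b' * c) * (c' * b + d' * d) -
    (a' * b + b' * d) * (c' * a + d' * c) =
    (a' * d' - b' * c') * (a * d - b * c) by ring.
  exact: mulr_gt0.
move=> q hq /=; rewrite fp2 (E' (f q)).
  rewrite E // fp2 /=; congr (_, _); ring.
rewrite -fp2; apply: le_lt_trans (hC _ _) _.
by rewrite mulrC -ltr_pdivlMr //; lra.
Qed.

Lemma pl_homeo_comp f g h k : pl_homeo f g -> pl_homeo h k ->
  pl_homeo (h \o f) (g \o k).
Proof.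
move=> Hf [hk kh Lh Lk dh]; have [fg gf Lf Lg df] := Hf; split.
- by move=> p /=; rewrite hk fg.
- by move=> p /=; rewrite gf kh.
- exact: lipschitz1_comp.
- exact: lipschitz1_comp.
- exact: dense_affine_comp Hf dh.
Qed.

Lemma pl_homeo_inv f g : pl_homeo f g -> pl_homeo g f.
Proof.
move=> [fg gf Lf Lg df]; split=> // y r r0.
have [s s0 hs] := @lipschitz1_image_ball g f y r gf fg Lf r0.
have [p1 [r1 [r10 le1 [a [b [c [d [det E]]]]]]]] := df (g y) s s0.
have f1in : dist1 y (f p1) < r by apply: hs; lra.
have [t t0 ht] := @lipschitz1_image_ball f g p1 r1 fg gf Lg r10.
pose r3 := Num.min (r - dist1 y (f p1)) t.
have r30 : 0 < r3 by rewrite lt_min t0; lra.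
have [r3a r3b] : r3 <= r - dist1 y (f p1) /\ r3 <= t.
  by split; rewrite ge_min lexx ?orbT.
exists (f p1), r3; split=> //; first lra.
pose e := a * d - b * c.
have e0 : e != 0 by rewrite gt_eqF.
exists (d / e), (- b / e), (- c / e), (a / e); split.
  have -> : d / e * (a / e) - - b / e * (- c / e) = e / (e * e).
    by rewrite /e; field.
  by rewrite divr_gt0 // mulr_gt0.
move=> z hz; rewrite fg.
have gz : dist1 p1 (g z) < r1 by apply: ht; lra.
have := E _ gz; rewrite gf; case: (g z) => x1 x2 /= Ez.
by rewrite [X in X.1 - _]Ez [X in X.2 - _]Ez /=; congr (_, _); rewrite /e; field.
Qed.

Lemma pl_homeo_id : pl_homeo id id.
Proof.
have L : lipschitz1 id by exists 1 => // p q; rewrite mul1r.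
split=> // p r r0; exists p, r; rewrite dist1xx add0r; split=> //.
exists 1, 0, 0, 1; split; first lra.
move=> [a b] _ /=; congr (_, _); ring.
Qed.

Definition hshear u p : pt := (u p, p.2).

(** Each horizontal line is mapped onto itself with slope at least [m]; this gives the inverse, and
    together with the Lipschitz constant of [u] it makes the inverse Lipschitz across lines. *)
Lemma pl_homeo_hshear u (m : R) : plR u -> 0 < m ->
  (forall x x' y, x <= x' -> m * (x' - x) <= u (x', y) - u (x, y)) ->
  exists g, pl_homeo (hshear u) g.
Proof.
move=> [[C C0 hC] du] m0 slope.
have mono x x' y : m * `|x' - x| <= `|u (x', y) - u (x, y)|.
  have [le|/ltW le] := leP x x'.
    by rewrite ger0_norm ?subr_ge0 // (le_trans (slope _ _ y le)) // ler_norm.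
  rewrite distrC ger0_norm ?subr_ge0 // distrC.
  by rewrite (le_trans (slope _ _ y le)) // ler_norm.
have surj z : exists x, u (x, z.2) = z.1.
  case: z => z y /=.
  (* At distance [B] from 0 the slope bound has already forced [u] past the value [z] on either
     side. *)
  pose B := `|z - u (0, y)| / m.
  have B0 : 0 <= B by rewrite divr_ge0 // ltW.
  have mB : m * B = `|z - u (0, y)| by rewrite /B mulrC divfK // gt_eqF.
  have h1 := slope 0 B y B0.
  have h2 : m * (0 - (- B)) <= u (0, y) - u (- B, y) by apply: slope; lra.
  have h3 : - `|z - u (0, y)| <= z - u (0, y) <= `|z - u (0, y)|.
    by rewrite -ler_norml.
  have [|||x _ ux] := @IVT R (fun x => u (x, y)) (- B) B z.
  - lra.
  - apply: continuous_subspaceT => x.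
    apply/cvgrPdist_lt => e e0.
    near=> t.
    have : `|x - t| < e / C.
      near: t; apply/nbhs_ballP; exists (e / C) => //=.
      exact: divr_gt0.
    rewrite ltr_pdivlMr // mulrC; apply: le_lt_trans.
    by have := hC (x, y) (t, y); rewrite /dist1 /= subrr normr0 addr0.
  - have le : u (- B, y) <= u (B, y) by lra.
    rewrite (min_l le) (max_r le); apply/andP; split; lra.
  - by exists x.
have [k hk] := choice surj.
have inj x x' y : u (x, y) = u (x', y) -> x = x'.
  move=> e; have := mono x x' y; rewrite e subrr normr0 => h.
  have : `|x' - x| <= 0 by have := normr_ge0 (x' - x); nra.
  by rewrite normr_le0 subr_eq0 => /eqP.
exists (fun z => (k z, z.2)); split.
- move=> [x y] /=; congr (_, _); apply: (inj _ _ y).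
  exact: hk (u (x, y), y).
- by move=> [x y]; rewrite /hshear hk.
- exists (C + 1) => [|p q]; first lra.
  have := hC p q; rewrite /hshear /dist1 /= mulrDl => h.
  by have := normr_ge0 (p.1 - q.1); lra.
- exists ((1 + C) / m + 1) => [|p q].
    by have : 0 < (1 + C) / m by [apply: divr_gt0; lra]; lra.
  rewrite /dist1 /=.
  have h1 := mono (k q) (k p) p.2.
  have h2 := hC (k q, p.2) (k q, q.2).
  rewrite /dist1 /= subrr normr0 add0r hk in h2.
  rewrite hk in h1.
  have h3 : m * `|k p - k q| <= `|p.1 - q.1| + C * `|p.2 - q.2|.
    apply: (le_trans h1).
    have -> : p.1 - u (k q, p.2) = (p.1 - q.1) - (u (k q, p.2) - q.1) by ring.
    by apply: le_trans (ler_normB _ _) _; rewrite lerD2l.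
  have h4 : `|k p - k q| <= (`|p.1 - q.1| + C * `|p.2 - q.2|) / m.
    by rewrite ler_pdivlMr // mulrC.
  apply: le_trans (lerD h4 (lexx _)) _.
  rewrite (mulrDl _ 1) mul1r mulrAC.
  have := normr_ge0 (p.1 - q.1); have := normr_ge0 (p.2 - q.2).
  move: `|p.1 - q.1| `|p.2 - q.2| => x y y0 x0.
  have : (x + C * y) / m <= (1 + C) * (x + y) / m.
    by rewrite ler_pM2r ?invr_gt0 //; nra.
  lra.
move=> p r r0; have [p' [r' [r'0 le [a [b E]]]]] := du p r r0.
exists p', r'; split=> //; exists a, b, 0, 1; split.
  (* The matrix has rows (a, b) and (0, 1), so its determinant is [a]; testing the slope bound
     between [p'] and this point gives [m <= a]. *)
  pose q := (p'.1 + r' / 2, p'.2).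
  have hq : dist1 p' q < r'.
    rewrite /dist1 /q /= subrr normr0 addr0 opprD addrA subrr add0r normrN gtr0_norm; lra.
  have := E _ hq; have := slope p'.1 (p'.1 + r' / 2) p'.2.
  rewrite /q /= -surjective_pairing => /(_ ltac:(lra)).
  have -> : p'.1 + r' / 2 - p'.1 = r' / 2 by ring.
  move: (u _) (u _) => w' w h1 h2.
  have h3 : m * (r' / 2) <= a * (r' / 2).
    have : w - w' = a * (r' / 2) by rewrite h2; ring.
    lra.
  have : m <= a by rewrite -(@ler_pM2r _ (r' / 2)) //; lra.
  lra.
move=> q hq; rewrite /hshear E //=; congr (_, _); ring.
Unshelve. all: by end_near.
Qed.

Definition flip p : pt := (p.2, p.1).

Lemma dist1_flip p q : dist1 (flip p) (flip q) = dist1 p q.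
Proof. by rewrite /dist1 addrC. Qed.

(** The flip reverses orientation, but conjugating uses it twice, so determinants stay positive. *)
Lemma pl_homeo_flip f g : pl_homeo f g ->
  pl_homeo (fun p => flip (f (flip p))) (fun p => flip (g (flip p))).
Proof.
move=> [fg gf [C C0 hC] [C' C'0 hC'] df].
have flipK p : flip (flip p) = p by case: p.
split.
- by move=> p; rewrite flipK fg flipK.
- by move=> p; rewrite flipK gf flipK.
- by exists C => // p q; rewrite dist1_flip (le_trans (hC _ _)) // dist1_flip.
- by exists C' => // p q; rewrite dist1_flip (le_trans (hC' _ _)) // dist1_flip.
move=> p r r0; have [p' [r' [r'0 le [a [b [c [d [det E]]]]]]]] := df (flip p) r r0.
exists (flip p'), r'; split=> //.
  by rewrite -dist1_flip flipK.
exists d, c, b, a; split; first lra.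
move=> q hq; rewrite flipK E; last by rewrite -dist1_flip flipK.
by rewrite /flip /=; congr (_, _); ring.
Qed.

Lemma pl_homeo_diag (a b c d : R) : 0 < a -> 0 < b ->
  pl_homeo (fun p => (c + a * p.1, d + b * p.2))
           (fun p => ((p.1 - c) / a, (p.2 - d) / b)).
Proof.
move=> a0 b0.
have a0' : a != 0 by rewrite gt_eqF.
have b0' : b != 0 by rewrite gt_eqF.
have L (a' b' c' d' : R) : 0 < a' -> 0 < b' ->
    lipschitz1 (fun p => (c' + a' * p.1, d' + b' * p.2)).
  move=> a'0 b'0; exists (a' + b') => [|p q]; first lra.
  rewrite /dist1 /=.
  have -> : c' + a' * p.1 - (c' + a' * q.1) = a' * (p.1 - q.1) by ring.
  have -> : d' + b' * p.2 - (d' + b' * q.2) = b' * (p.2 - q.2) by ring.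
  rewrite !normrM.
  rewrite (gtr0_norm a'0) (gtr0_norm b'0).
  have := normr_ge0 (p.1 - q.1); have := normr_ge0 (p.2 - q.2).
  by move: `|_| `|_| => x y; nra.
split.
- by move=> [x y] /=; congr (_, _); field.
- by move=> [x y] /=; congr (_, _); field.
- exact: L.
- have -> : (fun p => ((p.1 - c) / a, (p.2 - d) / b)) =
      (fun p => (- c / a + a^-1 * p.1, - d / b + b^-1 * p.2)).
    by apply/funext => p; congr (_, _); ring.
  by apply: L; rewrite invr_gt0.
move=> p r r0; exists p, r; rewrite dist1xx add0r; split=> //.
exists a, 0, 0, b; split; first by rewrite mul0r subr0 mulr_gt0.
by move=> q _ /=; congr (_, _); ring.
Qed.

End Plane.

(** * Moves supported in a square *)

Section Cell.
Context {R : realType}.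
Notation pt := (R * R)%type.
Implicit Types (p q : pt) (f g h : pt -> pt) (u v : pt -> R).

Definition slope_ge (m : R) u :=
  forall x x' y, x <= x' -> m * (x' - x) <= u (x', y) - u (x, y).

Lemma slope_ge_max (m : R) u v : slope_ge m u -> slope_ge m v ->
  slope_ge m (fun p => Num.max (u p) (v p)).
Proof.
move=> su sv x x' y le; have := su x x' y le; have := sv x x' y le.
by case: (leP (u (x, y)) (v (x, y))); case: (leP (u (x', y)) (v (x', y))); lra.
Qed.

Lemma slope_ge_min (m : R) u v : slope_ge m u -> slope_ge m v ->
  slope_ge m (fun p => Num.min (u p) (v p)).
Proof.
move=> su sv x x' y le; have := su x x' y le; have := sv x x' y le.
by case: (leP (u (x, y)) (v (x, y))); case: (leP (u (x', y)) (v (x', y))); lra.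
Qed.

Lemma slope_ge_affine (m a b c : R) : m <= a ->
  slope_ge m (fun p => a * p.1 + b * p.2 + c).
Proof. by move=> ma x x' y le /=; nra. Qed.

Lemma slope_ge_add_snd (m : R) u v : slope_ge m u ->
  (forall x x' y, v (x, y) = v (x', y)) -> slope_ge m (fun p => u p + v p).
Proof.
by move=> su hv x x' y le; rewrite (hv x' x y); have := su x x' y le; lra.
Qed.

Definition open_sq p := `|p.1| < 1 /\ `|p.2| < 1.

(* The first coordinate of the map below is [max lo (min hi l)], where
   [lo <= x <= hi] are increasing in [x], coincide with [x] outside the square,
   and enclose the affine function [l] on the box. *)
Lemma horizontal_move (k s c eta x0 y0 w w' : R) : 0 < k -> 0 < eta ->
  0 <= w -> 0 <= w' -> `|x0| + w' <= 1 - eta -> `|y0| + w <= 1 - eta ->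
  (forall x y, `|x - x0| <= w' -> `|y - y0| <= w ->
     `|k * x + s * y + c| <= 1 - eta) ->
  exists h g, [/\ pl_homeo h g, forall p, ~ open_sq p -> h p = p &
    forall p, `|p.1 - x0| <= w' -> `|p.2 - y0| <= w ->
      h p = (k * p.1 + s * p.2 + c, p.2)].
Proof.
move=> k0 eta0 w0 w'0 hx0 hy0 hl.
have eta1 : eta <= 1 by have := normr_ge0 x0; lra.
(* The steep slope [K] climbs from -1 to 1 over a width [eta]; the shallow slope [m] accounts for at
   most [eta] over the full width 2. Hence, for x between -1 + eta and 1 - eta, [up] is at least 1 -
   eta and [dn] at most -1 + eta, which encloses [l] on the box. *)
pose K := 2 / eta; pose m := eta / 2.
have Keta : K * eta = 2 by rewrite /K divfK // gt_eqF.
have K2 : 2 <= K by rewrite /K ler_pdivlMr //; lra.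
have m0 : 0 < m by rewrite /m; lra.
have m1 : m <= 1 / 2 by rewrite /m; lra.
(* Zero on the strip |y - y0| <= w, and at least [eta] once |y| >= 1; there [K * fade] is at least
   2, the width of the square, and the enclosure collapses to the identity. *)
pose fade (p : pt) := Num.max 0 (Num.max (p.2 - y0) (y0 - p.2) - w).
pose up (p : pt) := Num.min (-1 + K * (p.1 + 1)) (1 - m * (1 - p.1)).
pose dn (p : pt) := Num.max (1 - K * (1 - p.1)) (-1 + m * (1 + p.1)).
pose hi (p : pt) := Num.max p.1 (up p - K * fade p).
pose lo (p : pt) := Num.min p.1 (dn p + K * fade p).
pose l (p : pt) := k * p.1 + s * p.2 + c.
pose u (p : pt) := Num.max (lo p) (Num.min (hi p) (l p)).
have aff a b d (v : pt -> R) : (forall p, a * p.1 + b * p.2 + d = v p) -> plR v.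
  by move=> E; have -> : v = (fun p => a * p.1 + b * p.2 + d);
    [apply/funext => p; rewrite E | exact: plR_affine].
have affs mu a b d (v : pt -> R) : (forall p, a * p.1 + b * p.2 + d = v p) ->
    mu <= a -> slope_ge mu v.
  by move=> E; have -> : v = (fun p => a * p.1 + b * p.2 + d);
    [apply/funext => p; rewrite E | exact: slope_ge_affine].
have pfade : plR fade.
  apply: plR_max; first by apply: (aff 0 0 0) => p; ring.
  apply: plR_add; last by apply: (aff 0 0 (- w)) => p; ring.
  apply: plR_max; first by apply: (aff 0 1 (- y0)) => p; ring.
  by apply: (aff 0 (- 1) y0) => p; ring.
have pup : plR up.
  apply: plR_min; first by apply: (aff K 0 (K - 1)) => p; ring.
  by apply: (aff m 0 (1 - m)) => p; ring.
have pdn : plR dn.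
  apply: plR_max; first by apply: (aff K 0 (1 - K)) => p; ring.
  by apply: (aff m 0 (m - 1)) => p; ring.
have pfst : plR (fun p : pt => p.1) by apply: (aff 1 0 0) => p; ring.
have pu : plR u.
  apply: plR_max; last apply: plR_min; last exact: plR_affine.
  - by apply: plR_min => //; apply: plR_add => //; exact: plR_scale.
  - apply: plR_max => //; apply: plR_add => //.
    by apply: plR_opp; exact: plR_scale.
pose mu := Num.min m k.
have mu0 : 0 < mu by rewrite lt_min m0.
have [mum muk] : mu <= m /\ mu <= k by rewrite /mu !ge_min !lexx orbT.
have su : slope_ge mu u.
  have sfst : slope_ge mu (fun p : pt => p.1).
    by apply: (affs _ 1 0 0) => [p|]; [ring | lra].
  apply: slope_ge_max; last apply: slope_ge_min.
  - apply: slope_ge_min => //; apply: slope_ge_add_snd => //.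
    apply: slope_ge_max; first by apply: (affs _ K 0 (1 - K)) => [p|]; [ring | lra].
    by apply: (affs _ m 0 (m - 1)) => [p|]; [ring | lra].
  - apply: slope_ge_max => //; apply: slope_ge_add_snd => //.
    apply: slope_ge_min; first by apply: (affs _ K 0 (K - 1)) => [p|]; [ring | lra].
    by apply: (affs _ m 0 (1 - m)) => [p|]; [ring | lra].
  - exact: slope_ge_affine.
have [g Hg] := pl_homeo_hshear pu mu0 su.
exists (hshear u), g; split=> // -[x y].
  move=> out; rewrite /hshear /=; congr (_, _).
  have f0 : 0 <= K * fade (x, y).
    by apply: mulr_ge0; [lra | rewrite /fade le_max lexx].
  have out3 : x >= 1 \/ x <= -1 \/ (-1 <= x <= 1 /\ 2 <= K * fade (x, y)).
    have [|] := leP 1 x; first by left.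
    have [|] := leP x (- 1); first by right; left.
    move=> x1 x2; right; right; split; first by apply/andP; split; lra.
    rewrite -Keta ler_pM2l; last lra.
    rewrite /fade /= le_max; apply/orP; right.
    have y1 : 1 <= `|y|.
      rewrite leNgt; apply/negP => y1; apply: out; split=> //=.
      by rewrite ltr_norml; apply/andP; split; lra.
    have := ler_norm y0; have := ler_norm (- y0); rewrite normrN.
    move: y1; case: (leP (y - y0) (y0 - y)); case: (ger0P y); lra.
  have hiE : hi (x, y) = x.
    apply: max_l => /=.
    have [a b] : up (x, y) <= -1 + K * (x + 1) /\ up (x, y) <= 1 - m * (1 - x).
      by rewrite /up !ge_min !lexx orbT.
    by case: out3 => [h|[h|[/andP [h1 h2] h3]]]; nra.
  have loE : lo (x, y) = x.
    apply: min_l => /=.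
    have [a b] : 1 - K * (1 - x) <= dn (x, y) /\ -1 + m * (1 + x) <= dn (x, y).
      by rewrite /dn !le_max !lexx orbT.
    by case: out3 => [h|[h|[/andP [h1 h2] h3]]]; nra.
  rewrite /u hiE loE; case: (leP x (l (x, y))) => [le|lt]; first by rewrite maxxx.
  by rewrite max_l // ltW.
move=> /= hx hy; rewrite /hshear /=; congr (_, _).
have := hl x y hx hy; rewrite ler_norml => /andP [l1 l2].
have fE : fade (x, y) = 0.
  move: hy; rewrite ler_norml /fade /= => /andP [h1 h2]; apply: max_l.
  by case: (leP (y - y0) (y0 - y)); lra.
have [x1 x2] : -1 + eta <= x /\ x <= 1 - eta.
  move: hx; rewrite ler_norml => /andP [? ?].
  have := ler_norm x0; have := ler_norm (- x0); rewrite normrN; split; lra.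
have hiE : l (x, y) <= hi (x, y).
  rewrite /hi le_max; apply/orP; right; rewrite fE mulr0 subr0 /up /= /l /=.
  by rewrite le_min; apply/andP; split; rewrite /m; nra.
have loE : lo (x, y) <= l (x, y).
  rewrite /lo ge_min; apply/orP; right; rewrite fE mulr0 addr0 /dn /= /l /=.
  by rewrite ge_max; apply/andP; split; rewrite /m; nra.
by rewrite /u (min_r hiE) (max_r loE).
Qed.

Lemma vertical_move (k s c eta x0 y0 w w' : R) : 0 < k -> 0 < eta ->
  0 <= w -> 0 <= w' -> `|x0| + w <= 1 - eta -> `|y0| + w' <= 1 - eta ->
  (forall x y, `|x - x0| <= w -> `|y - y0| <= w' ->
     `|k * y + s * x + c| <= 1 - eta) ->
  exists h g, [/\ pl_homeo h g, forall p, ~ open_sq p -> h p = p &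
    forall p, `|p.1 - x0| <= w -> `|p.2 - y0| <= w' ->
      h p = (p.1, k * p.2 + s * p.1 + c)].
Proof.
move=> k0 eta0 w0 w'0 hx0 hy0 hl.
have [|h [g [H out E]]] :=
  @horizontal_move k s c eta y0 x0 w w' k0 eta0 w0 w'0 hy0 hx0.
  by move=> x y hx hy; exact: hl.
exists (fun p => flip (h (flip p))), (fun p => flip (g (flip p))); split.
- exact: pl_homeo_flip.
- move=> [x y] no; rewrite out //.
  by move=> [a b]; apply: no.
- by move=> [x y] hx hy; rewrite E.
Qed.

(* For injective [f], this says that [f'] is [f] followed by a map supported
   in [U]. *)
Definition moved_in (U : pt -> Prop) f' f :=
  forall p, f' p = f p \/ U (f p) /\ U (f' p).

Lemma moved_in_trans U f1 f2 f3 :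
  moved_in U f1 f2 -> moved_in U f2 f3 -> moved_in U f1 f3.
Proof.
move=> h12 h23 p; case: (h12 p) (h23 p) => [->|[a b]] [e|[c d]].
- by left.
- by right.
- by right; rewrite -e.
- by right.
Qed.

Lemma moved_in_refl U f : moved_in U f f.
Proof. by move=> p; left. Qed.

Lemma moved_in_comp U f h : injective h -> (forall p, ~ U p -> h p = p) ->
  moved_in U (h \o f) f.
Proof.
move=> ih out p /=; have [u|] := pselect (U (f p)); last by left; exact: out.
right; split=> //; have [//|/out/ih e] := pselect (U (h (f p))).
by rewrite e.
Qed.

(** The radius is existential, so it may shrink at each further move. What remains is a calculus of
    values and matrices, in which moves supported in the square act as row operations. *)
Definition germ f p0 (z : pt) (a b c d : R) := exists f' g' r,
  [/\ pl_homeo f' g', moved_in open_sq f' f, 0 < r &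
    forall q, dist1 p0 q < r ->
      f' q = (z.1 + a * (q.1 - p0.1) + b * (q.2 - p0.2),
              z.2 + c * (q.1 - p0.1) + d * (q.2 - p0.2))].

Lemma germ_comp f p0 (z z' : pt) (a b c d a' b' c' d' t : R) h k :
  germ f p0 z a b c d -> pl_homeo h k -> (forall p, ~ open_sq p -> h p = p) ->
  0 < t ->
  (forall p, `|p.1 - z.1| <= t -> `|p.2 - z.2| <= t ->
    h p = (z'.1 + a' * (p.1 - z.1) + b' * (p.2 - z.2),
           z'.2 + c' * (p.1 - z.1) + d' * (p.2 - z.2))) ->
  germ f p0 z' (a' * a + b' * c) (a' * b + b' * d)
               (c' * a + d' * c) (c' * b + d' * d).
Proof.
move=> [f' [g' [r [Hf mv r0 E]]]] Hh out t0 Eh.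
have [S S0 hS] : exists2 S : R, 0 < S & forall x y : R,
    `|a * x + b * y| <= S * (`|x| + `|y|) /\ `|c * x + d * y| <= S * (`|x| + `|y|).
  exists (`|a| + `|b| + `|c| + `|d| + 1).
    have := normr_ge0 a; have := normr_ge0 b; have := normr_ge0 c.
    by have := normr_ge0 d; lra.
  move=> x y; split; apply: le_trans (ler_normD _ _) _; rewrite !normrM;
  have := normr_ge0 a; have := normr_ge0 b; have := normr_ge0 c;
  have := normr_ge0 d; have := normr_ge0 x; have := normr_ge0 y;
  move: `|a| `|b| `|c| `|d| `|x| `|y| => A B C0 D0 X Y ? ? ? ? ? ?; nra.
exists (h \o f'), (g' \o k), (Num.min r (t / S)); split.
- exact: pl_homeo_comp Hh.
- apply: moved_in_trans mv; apply: moved_in_comp => //.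
  by case: Hh => hk _ _ _ _; exact: can_inj hk.
- by rewrite lt_min r0 divr_gt0.
move=> q; rewrite lt_min => /andP [hq]; rewrite ltr_pdivlMr // mulrC => hq2.
have [s1 s2] := hS (q.1 - p0.1) (q.2 - p0.2).
have dE : `|q.1 - p0.1| + `|q.2 - p0.2| = dist1 p0 q by rewrite dist1C.
rewrite dE in s1 s2.
have cancelz (x y w : R) : x + y + w - x = y + w by ring.
rewrite /= E // Eh /=; last 2 first.
- by rewrite cancelz; lra.
- by rewrite cancelz; lra.
by congr (_, _); ring.
Qed.

Lemma germ_horizontal f p0 (z z' : pt) (a b c d k s : R) :
  germ f p0 z a b c d -> open_sq z -> open_sq z' -> z'.2 = z.2 -> 0 < k ->
  germ f p0 z' (k * a + s * c) (k * b + s * d) c d.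
Proof.
move=> G [z1 z2] [z'1 _] e k0.
(* Half the least distance from the sides: a box of half-width [eta] about [z], and any displacement
   of at most [eta] from [z'], stay at distance [eta] from the boundary. *)
pose eta := Num.min (Num.min (1 - `|z.1|) (1 - `|z.2|)) (1 - `|z'.1|) / 2.
have eta0 : 0 < eta.
  by apply: divr_gt0 => //; rewrite !lt_min !subr_gt0 z1 z2 z'1.
have [e1 e2 e3] : [/\ 2 * eta <= 1 - `|z.1|, 2 * eta <= 1 - `|z.2| &
    2 * eta <= 1 - `|z'.1|].
  have -> : 2 * eta = Num.min (Num.min (1 - `|z.1|) (1 - `|z.2|)) (1 - `|z'.1|).
    by rewrite /eta mulrC divfK.
  by rewrite !ge_min !lexx !orbT.
pose t := eta / (k + `|s| + 1).
have s0 := normr_ge0 s.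
have t0 : 0 < t by apply: divr_gt0 => //; lra.
have tE : t * (k + `|s| + 1) = eta by rewrite /t divfK // gt_eqF //; lra.
have tle : t <= eta by nra.
have [|||||h [h' [Hh out E]]] := @horizontal_move k s
    (z'.1 - k * z.1 - s * z.2) eta z.1 z.2 t t k0 eta0; try lra.
  move=> x y hx hy.
  have -> : k * x + s * y + (z'.1 - k * z.1 - s * z.2) =
    z'.1 + (k * (x - z.1) + s * (y - z.2)) by ring.
  apply: le_trans (ler_normD _ _) _.
  have : `|k * (x - z.1) + s * (y - z.2)| <= k * t + `|s| * t.
    apply: le_trans (ler_normD _ _) _; rewrite !normrM (gtr0_norm k0).
    by apply: lerD; [apply: ler_wpM2l; lra | exact: ler_wpM2l].
  have : k * t + `|s| * t <= eta by nra.
  lra.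
have := @germ_comp f p0 z z' a b c d k s 0 1 t h h' G Hh out t0.
rewrite !mul0r !add0r !mul1r; apply=> p h1 h2.
by rewrite E // e; congr (_, _); ring.
Qed.

Lemma germ_vertical f p0 (z z' : pt) (a b c d k s : R) :
  germ f p0 z a b c d -> open_sq z -> open_sq z' -> z'.1 = z.1 -> 0 < k ->
  germ f p0 z' a b (k * c + s * a) (k * d + s * b).
Proof.
move=> G [z1 z2] [_ z'2] e k0.
pose eta := Num.min (Num.min (1 - `|z.1|) (1 - `|z.2|)) (1 - `|z'.2|) / 2.
have eta0 : 0 < eta.
  by apply: divr_gt0 => //; rewrite !lt_min !subr_gt0 z1 z2 z'2.
have [e1 e2 e3] : [/\ 2 * eta <= 1 - `|z.1|, 2 * eta <= 1 - `|z.2| &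
    2 * eta <= 1 - `|z'.2|].
  have -> : 2 * eta = Num.min (Num.min (1 - `|z.1|) (1 - `|z.2|)) (1 - `|z'.2|).
    by rewrite /eta mulrC divfK.
  by rewrite !ge_min !lexx !orbT.
pose t := eta / (k + `|s| + 1).
have s0 := normr_ge0 s.
have t0 : 0 < t by apply: divr_gt0 => //; lra.
have tE : t * (k + `|s| + 1) = eta by rewrite /t divfK // gt_eqF //; lra.
have tle : t <= eta by nra.
have [|||||h [h' [Hh out E]]] := @vertical_move k s
    (z'.2 - k * z.2 - s * z.1) eta z.1 z.2 t t k0 eta0; try lra.
  move=> x y hx hy.
  have -> : k * y + s * x + (z'.2 - k * z.2 - s * z.1) =
    z'.2 + (k * (y - z.2) + s * (x - z.1)) by ring.
  apply: le_trans (ler_normD _ _) _.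
  have : `|k * (y - z.2) + s * (x - z.1)| <= k * t + `|s| * t.
    apply: le_trans (ler_normD _ _) _; rewrite !normrM (gtr0_norm k0).
    by apply: lerD; [apply: ler_wpM2l; lra | exact: ler_wpM2l].
  have : k * t + `|s| * t <= eta by nra.
  lra.
have := @germ_comp f p0 z z' a b c d 1 0 s k t h h' G Hh out t0.
rewrite !mul0r !addr0 !mul1r ![s * _ + _]addrC; apply=> p h1 h2.
by rewrite E // e; congr (_, _); ring.
Qed.

Lemma open_sq0 : open_sq (0, 0).
Proof. by rewrite /open_sq /= normr0. Qed.

(* Every matrix of positive determinant is reduced to the identity by the
   row operations available on germs. *)
Lemma germ_diag f p0 (a b c d n1 n2 : R) : germ f p0 (0, 0) a b c d ->
  0 < a * d - b * c -> 0 < n1 -> 0 < n2 -> germ f p0 (0, 0) n1 0 0 n2.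
Proof.
move=> G det n10 n20; have sq := open_sq0.
have hor k s a1 b1 c1 d1 : germ f p0 (0, 0) a1 b1 c1 d1 -> 0 < k ->
    germ f p0 (0, 0) (k * a1 + s * c1) (k * b1 + s * d1) c1 d1.
  by move=> G1 k0; exact: germ_horizontal G1 _ _ _ k0.
have ver k s a1 b1 c1 d1 : germ f p0 (0, 0) a1 b1 c1 d1 -> 0 < k ->
    germ f p0 (0, 0) a1 b1 (k * c1 + s * a1) (k * d1 + s * b1).
  by move=> G1 k0; exact: germ_vertical G1 _ _ _ k0.
(* With a positive corner entry, a vertical shear clears [c1] and leaves det / a1 > 0 below; a
   horizontal one then clears [b1], and rescaling the rows gives [n1] and [n2]. *)
have stepc a1 b1 c1 d1 : germ f p0 (0, 0) a1 b1 c1 d1 ->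
    0 < a1 * d1 - b1 * c1 -> 0 < a1 -> germ f p0 (0, 0) n1 0 0 n2.
  move=> G1 det1 a0; have a0' : a1 != 0 by rewrite gt_eqF.
  pose d2 := d1 - c1 / a1 * b1.
  have d20 : 0 < d2.
    have -> : d2 = (a1 * d1 - b1 * c1) / a1 by rewrite /d2; field.
    exact: divr_gt0.
  have d20' : d2 != 0 by rewrite gt_eqF.
  have := ver 1 (- (c1 / a1)) _ _ _ _ G1 ltr01.
  have -> : 1 * c1 + - (c1 / a1) * a1 = 0 by field.
  have -> : 1 * d1 + - (c1 / a1) * b1 = d2 by rewrite /d2; ring.
  move=> /(hor (n1 / a1) (- (n1 / a1 * b1 / d2))) /(_ (divr_gt0 n10 a0)).
  have -> : n1 / a1 * a1 + - (n1 / a1 * b1 / d2) * 0 = n1.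
    by field; rewrite a0' d20'.
  have -> : n1 / a1 * b1 + - (n1 / a1 * b1 / d2) * d2 = 0.
    by field; rewrite a0' d20'.
  move=> /(ver (n2 / d2) 0) /(_ (divr_gt0 n20 d20)).
  have -> : n2 / d2 * 0 + 0 * n1 = 0 by ring.
  by have -> : n2 / d2 * d2 + 0 * 0 = n2 by field.
(* A nonzero [c1] allows a multiple of the second row to turn the corner entry into 1 without
   changing the determinant. *)
have stepa a1 b1 c1 d1 : germ f p0 (0, 0) a1 b1 c1 d1 ->
    0 < a1 * d1 - b1 * c1 -> c1 != 0 -> germ f p0 (0, 0) n1 0 0 n2.
  move=> G1 det1 c0.
  have := hor 1 ((1 - a1) / c1) _ _ _ _ G1 ltr01.
  have -> : 1 * a1 + (1 - a1) / c1 * c1 = 1 by field.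
  move/stepc; apply=> //.
  suff -> : 1 * d1 - (1 * b1 + (1 - a1) / c1 * d1) * c1 = a1 * d1 - b1 * c1 by [].
  by field.
have [c0|c0] := eqVneq c 0; last exact: stepa G det c0.
(* If [c] is 0 then [a] is not, and adding the first row to the second makes the lower left entry
   nonzero. *)
have a0 : a != 0.
  by apply/eqP => a0; move: det; rewrite a0 c0 mul0r mulr0 subr0 ltxx.
have := ver 1 1 _ _ _ _ G ltr01; move/stepa; apply; first lra.
by rewrite c0 mulr0 add0r mul1r.
Qed.

(** The model case of one cell. The factors [n1] and [n2] prescribe an anisotropy, to be cancelled
    when the square is stretched onto a rectangular cell. *)
Lemma fill_square f g (E : pt -> Prop) (n1 n2 delta : R) : pl_homeo f g ->
  dense_balls (fun p r => forall q, dist1 p q < r -> ~ E q) ->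
  0 < n1 -> 0 < n2 -> 0 < delta <= 1 / 2 ->
  exists f' g' p0 t,
    [/\ pl_homeo f' g', moved_in open_sq f' f, 0 < t &
      forall q, `|n1 * (q.1 - p0.1)| <= t -> `|n2 * (q.2 - p0.2)| <= t ->
        ~ E q /\ f' q = ((1 - delta) / t * (n1 * (q.1 - p0.1)),
                         (1 - delta) / t * (n2 * (q.2 - p0.2)))].
Proof.
move=> Hf dE n10 n20 /andP [de0 de1].
have [fg gf Lf Lg df] := Hf.
have [s s0 hs] := @lipschitz1_image_ball _ g f (0, 0) 1 gf fg Lf ltr01.
have [p0 [r [r0 le [[a [b [c [d [det A]]]]] noE]]]] :=
  dense_ballsI (affine_on_hereditary (f:=f)) df dE (g (0, 0)) s0.
have fp0 : open_sq (f p0).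
  have /hs : dist1 (g (0, 0)) p0 < s by lra.
  by move=> /dist1_lt_proj [] /=; rewrite !subr0.
have G0 : germ f p0 (f p0) a b c d.
  by exists f, g, r; split=> //; exact: moved_in_refl.
have sq2 : open_sq (0, (f p0).2).
  by split => /=; [rewrite normr0 | case: fp0].
have G1 := @germ_horizontal _ _ _ (0, (f p0).2) _ _ _ _ 1 0 G0 fp0 sq2 erefl ltr01.
have := @germ_vertical _ _ _ (0, 0) _ _ _ _ 1 0 G1 sq2 open_sq0 erefl ltr01.
rewrite !mul1r !mul0r !addr0 => G2.
have [f' [g' [r' [Hf' mv' r'0 E']]]] := germ_diag G2 det n10 n20.
pose rr := Num.min r r'.
have rr0 : 0 < rr by rewrite lt_min r0.
(* The first bound makes the box to be blown up fit in the square; the second puts the source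
   rectangle in the ball of radius [rr], where the map is diagonal and [E] is avoided. *)
pose t := Num.min (delta / 4) (rr / (2 * (n1^-1 + n2^-1))).
have i1 : 0 < n1^-1 by rewrite invr_gt0.
have i2 : 0 < n2^-1 by rewrite invr_gt0.
have t0 : 0 < t.
  by rewrite lt_min; apply/andP; split; apply: divr_gt0 => //; lra.
have [t1 t2] : t <= delta / 4 /\ t <= rr / (2 * (n1^-1 + n2^-1)).
  by rewrite /t !ge_min !lexx orbT.
pose k := (1 - delta) / t.
have k0 : 0 < k by apply: divr_gt0 => //; lra.
have kt : k * t = 1 - delta by rewrite /k divfK // gt_eqF.
have bnd x y : `|x| <= t -> `|k * x + 0 * y + 0| <= 1 - delta.
  move=> hx; rewrite mul0r !addr0 normrM (gtr0_norm k0) -kt.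
  by rewrite ler_pM2l.
have [|||h1 [h1' [H1 out1 E1]]] := @horizontal_move k 0 0 delta 0 0 t t k0 de0
  (ltW t0) (ltW t0).
- by rewrite normr0; lra.
- by rewrite normr0; lra.
- by move=> x y; rewrite subr0 => hx _; exact: bnd.
(* The blow-up takes two moves: after the horizontal one the box has half-widths 1 - delta and [t],
   and it is this flat box that is stretched vertically. *)
have [||||h2 [h2' [H2 out2 E2]]] :=
  @vertical_move k 0 0 delta 0 0 (1 - delta) t k0 de0 _ (ltW t0).
- by lra.
- by rewrite normr0; lra.
- by rewrite normr0; lra.
- by move=> x y _; rewrite subr0 => hy; exact: bnd.
exists (h2 \o (h1 \o f')), ((g' \o h1') \o h2'), p0, t; split=> //.
- by apply: pl_homeo_comp => //; exact: pl_homeo_comp.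
- apply: moved_in_trans; last apply: moved_in_trans mv'.
    apply: moved_in_comp => //.
    by case: H2 => hk _ _ _ _; exact: can_inj hk.
  apply: moved_in_comp => //.
  by case: H1 => hk _ _ _ _; exact: can_inj hk.
move=> q hx hy.
have dq : dist1 p0 q < rr.
  have hx' : `|q.1 - p0.1| <= n1^-1 * t.
    by move: hx; rewrite normrM (gtr0_norm n10) -ler_pdivlMl.
  have hy' : `|q.2 - p0.2| <= n2^-1 * t.
    by move: hy; rewrite normrM (gtr0_norm n20) -ler_pdivlMl.
  rewrite dist1C /dist1; apply: le_lt_trans (lerD hx' hy') _.
  rewrite -mulrDl.
  move: t2; move: (n1^-1 + n2^-1) (addr_gt0 i1 i2) => I I0.
  rewrite ler_pdivlMr ?mulr_gt0 //; lra.
have [dq1 dq2] : dist1 p0 q < r /\ dist1 p0 q < r'.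
  by move: dq; rewrite lt_min => /andP.
split; first exact: noE.
rewrite /= E' //= !mul0r !addr0 !add0r E1 /= ?subr0 //.
have hx2 := bnd _ 0 hx.
rewrite !mul0r !addr0 in hx2 *.
by rewrite -/k E2 /= ?subr0 //; congr (_, _); ring.
Qed.

End Cell.

(** * Filling the cells of a grid *)

Section Fill.
Context {R : realType}.
Notation pt := (R * R)%type.
Notation rect := ((R * R) * (R * R))%type.
Implicit Types (p q : pt) (f g h : pt -> pt) (c : rect) (i : rect * rect).
Implicit Types (E F : pt -> Prop) (xs ys : seq R).

(* A rectangle is given by its centre and its half-widths. *)
Definition closed_rect c p := `|p.1 - c.1.1| <= c.2.1 /\ `|p.2 - c.1.2| <= c.2.2.
Definition open_rect c p := `|p.1 - c.1.1| < c.2.1 /\ `|p.2 - c.1.2| < c.2.2.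

(** The first rectangle of [i] is the source and the second its image. Excluding rotations keeps
    both parallel to the axes, so that grids can contain their sides. *)
Definition homothetic f i := exists l : R,
  [/\ 0 < l, 0 < i.1.2.1 /\ 0 < i.1.2.2, i.2.2 = (l * i.1.2.1, l * i.1.2.2) &
    forall p, closed_rect i.1 p ->
      f p = (i.2.1.1 + l * (p.1 - i.1.1.1), i.2.1.2 + l * (p.2 - i.1.1.2))].

Definition swap_item i : rect * rect := (i.2, i.1).

Lemma homothetic_closed f i p : homothetic f i -> closed_rect i.1 p ->
  closed_rect i.2 (f p).
Proof.
move=> [l [l0 _ e E]] [h1 h2]; rewrite E //; split=> /=.
  by rewrite e /= addrC addKr normrM gtr0_norm // ler_pM2l.
by rewrite e /= addrC addKr normrM gtr0_norm // ler_pM2l.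
Qed.

Lemma homothetic_inv f g i : cancel f g -> homothetic f i ->
  homothetic g (swap_item i).
Proof.
move=> fg [l [l0 [w1 w2] e E]]; exists l^-1.
have l0' : l != 0 by rewrite gt_eqF.
split; rewrite ?invr_gt0 //=.
- by rewrite e; split; exact: mulr_gt0.
- by rewrite e /=; case: i.1.2 => a b /=; congr (_, _); field.
move=> q [h1 h2].
pose p : pt := (i.1.1.1 + l^-1 * (q.1 - i.2.1.1), i.1.1.2 + l^-1 * (q.2 - i.2.1.2)).
have hp : closed_rect i.1 p.
  split; rewrite /p /= addrC addKr normrM gtr0_norm ?invr_gt0 // ler_pdivrMl //.
    by move: h1; rewrite e.
  by move: h2; rewrite e.
suff e' : f p = q by rewrite -[in LHS]e' fg.
by rewrite E // /p /=; case: q {h1 h2 p hp} => a b /=; congr (_, _); field.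
Qed.

Lemma homothetic_open f g i p : cancel f g -> cancel g f -> homothetic f i ->
  open_rect i.2 (f p) -> open_rect i.1 p.
Proof.
move=> fg gf Hf; have [l [l0 [w1 w2] e E]] := homothetic_inv fg Hf.
rewrite /= in w1 w2 e E; move=> [h1 h2].
have := E (f p); rewrite fg => ->; last by split; exact: ltW.
by split; rewrite /= addrC addKr normrM gtr0_norm // e /= ltr_pM2l.
Qed.

Lemma map_swapK (D : seq (rect * rect)) : map swap_item (map swap_item D) = D.
Proof. by rewrite -map_comp map_id_in // => -[]. Qed.

(** The cell is rescaled to the unit square by a diagonal map. Asking there for the factors 1/w1 and
    1/w2 makes the composite a scalar multiple, of ratio (1 - delta) / t. *)
Lemma fill_rect f g E c (delta : R) : pl_homeo f g ->
  dense_balls (fun p r => forall q, dist1 p q < r -> ~ E q) ->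
  0 < c.2.1 -> 0 < c.2.2 -> 0 < delta <= 1 / 2 ->
  exists f' g' r, [/\ pl_homeo f' g', moved_in (open_rect c) f' f,
    homothetic f' (r, (c.1, ((1 - delta) * c.2.1, (1 - delta) * c.2.2))) &
    forall p, closed_rect r p -> ~ E p].
Proof.
case: c => [[c1 c2] [w1 w2]] /= Hf dE w10 w20 hd.
have Hd := @pl_homeo_diag R w1 w2 c1 c2 w10 w20.
have Hd' := pl_homeo_inv Hd.
have HF := pl_homeo_comp Hf Hd'.
have i1 : 0 < w1^-1 by rewrite invr_gt0.
have i2 : 0 < w2^-1 by rewrite invr_gt0.
have [F' [G' [p0 [t [HF' mv t0 h]]]]] := fill_square HF dE i1 i2 hd.
have w1' : w1 != 0 by rewrite gt_eqF.
have w2' : w2 != 0 by rewrite gt_eqF.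
have t0' : t != 0 by rewrite gt_eqF.
exists ((fun p => (c1 + w1 * p.1, c2 + w2 * p.2)) \o F'),
  (G' \o (fun p => ((p.1 - c1) / w1, (p.2 - c2) / w2))),
  (p0, (t * w1, t * w2)).
have sqE p : open_sq ((p.1 - c1) / w1, (p.2 - c2) / w2) ->
    open_rect ((c1, c2), (w1, w2)) p.
  rewrite /open_sq /open_rect /= !normrM (gtr0_norm i1) (gtr0_norm i2).
  by rewrite !ltr_pdivrMr // !mul1r.
have hr p : closed_rect (p0, (t * w1, t * w2)) p ->
  `|w1^-1 * (p.1 - p0.1)| <= t /\ `|w2^-1 * (p.2 - p0.2)| <= t.
  rewrite /closed_rect /= !normrM (gtr0_norm i1) (gtr0_norm i2).
  by rewrite !ler_pdivrMl // ![t * _]mulrC.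
split.
- exact: pl_homeo_comp HF' Hd.
- move=> p; case: (mv p) => [e|[a b]].
    by left; rewrite /= e /=; case: (f p) => x y /=; congr (_, _); field.
  right; split; first exact: sqE.
  apply: sqE => /=; move: b; case: (F' p) => x y /=.
  have -> : (c1 + w1 * x - c1) / w1 = x by field.
  by have -> : (c2 + w2 * y - c2) / w2 = y by field.
- exists ((1 - delta) / t); split=> /=.
  + by case/andP: hd => *; apply: divr_gt0 => //; lra.
  + by split; exact: mulr_gt0.
  + by congr (_, _); field.
  move=> p /hr [h1 h2]; rewrite /=.
  have [_ ->] := h p h1 h2.
  by congr (_, _) => /=; field; rewrite t0'.
move=> p /hr [h1 h2].
by have [] := h p h1 h2.
Qed.

Definition in_box (M : R) p := `|p.1| <= M /\ `|p.2| <= M.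

(* The stages of the construction. The items of [D] are pairs of rectangles on
   which the homeomorphism is already conformal; the rectangles avoid [E] in the
   domain and [F] in the range. *)
Definition stage (M : R) E F f g (D : seq (rect * rect)) :=
  [/\ pl_homeo f g, forall p, ~ in_box M p -> f p = p &
    forall i, i \in D -> [/\ homothetic f i, forall p, closed_rect i.1 p -> ~ E p &
      forall p, closed_rect i.2 p -> ~ F p]].

(** This symmetry is why a stage carries two avoided sets: filling the domain is filling the range
    of the inverse. *)
Lemma stage_swap M E F f g D : stage M E F f g D ->
  stage M F E g f (map swap_item D).
Proof.
move=> [Hf out hD]; have [fg gf _ _ _] := Hf; split.
- exact: pl_homeo_inv.
- by move=> p no; rewrite -[in LHS](out p no) fg.
- move=> _ /mapP [i /hD [a b d] ->]; split=> //.
  exact: homothetic_inv fg a.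
Qed.

Definition shrink (delta : R) c : rect :=
  (c.1, ((1 - delta) * c.2.1, (1 - delta) * c.2.2)).

Lemma shrink_subset delta c p : 0 < delta -> 0 < c.2.1 -> 0 < c.2.2 ->
  closed_rect (shrink delta c) p -> open_rect c p.
Proof. by move=> d0 w1 w2 [/= h1 h2]; split; nra. Qed.

Definition separated (C : seq rect) := forall c c' p,
  c \in C -> c' \in C -> open_rect c p -> open_rect c' p -> c = c'.

(** Cells are treated one at a time. One is skipped if it meets [F] or an image rectangle already
    present; otherwise a map supported in it cannot disturb the earlier items. *)
Lemma fill_cells M E F (delta : R) (C : seq rect) f g D :
  0 < delta <= 1 / 2 ->
  dense_balls (fun p r => forall q, dist1 p q < r -> ~ E q) ->
  separated C ->
  (forall c, c \in C -> [/\ 0 < c.2.1, 0 < c.2.2 &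
     forall p, open_rect c p -> in_box M p]) ->
  stage M E F f g D ->
  exists f' g' D', [/\ stage M E F f' g' D', {subset D <= D'},
    forall p, f' p = f p \/
      (exists2 c, c \in C & open_rect c (f p) /\ open_rect c (f' p)),
    forall i, i \in D' -> i \in D \/ (exists2 c, c \in C & i.2 = shrink delta c) &
    forall c, c \in C -> [\/ shrink delta c \in map snd D',
      (exists2 p, closed_rect c p & F p) |
      (exists2 i, i \in D & exists2 p, open_rect c p & closed_rect i.2 p)]].
Proof.
move=> hd dE; have [d0 d1] : 0 < delta /\ delta <= 1 / 2 by apply/andP.
elim: C => [|c C IH] sepC posC st.
  by exists f, g, D; split=> // [p|i]; left.
have [|| f1 [g1 [D1 [st1 sub1 mv1 new1 cov1]]]] := IH _ _ st.
- by move=> a b p ha hb; apply: sepC; rewrite in_cons ?ha ?hb orbT.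
- by move=> a ha; apply: posC; rewrite in_cons ha orbT.
have cC : c \in c :: C by rewrite mem_head.
have CC a : a \in C -> a \in c :: C by move=> h; rewrite in_cons h orbT.
have [w1 w2 boxc] := posC c cC.
have skip : [\/ shrink delta c \in map snd D1, (exists2 p, closed_rect c p & F p) |
      (exists2 i, i \in D & exists2 p, open_rect c p & closed_rect i.2 p)] ->
    exists f' g' D', [/\ stage M E F f' g' D', {subset D <= D'},
    forall p, f' p = f p \/
      (exists2 a, a \in c :: C & open_rect a (f p) /\ open_rect a (f' p)),
    forall i, i \in D' -> i \in D \/
      (exists2 a, a \in c :: C & i.2 = shrink delta a) &
    forall a, a \in c :: C -> [\/ shrink delta a \in map snd D',
      (exists2 p, closed_rect a p & F p) |
      (exists2 i, i \in D & exists2 p, open_rect a p & closed_rect i.2 p)]].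
  move=> hc; exists f1, g1, D1; split=> //.
  - by move=> p; case: (mv1 p) => [|[a /CC ha h]]; [left | right; exists a].
  - by move=> i /new1 [|[a /CC ha h]]; [left | right; exists a].
  - by move=> a; rewrite in_cons => /orP [/eqP ->|/cov1].
have [meetF|noF] := pselect (exists2 p, closed_rect c p & F p).
  by apply: skip; constructor 2.
(* A rectangle created in this very round lies inside its own cell, so by separation the cell it
   meets is that one and is already filled. Only rectangles of the original [D] give the third
   alternative. *)
have [[i iD1 [p pc pi]]|nomeet] :=
    pselect (exists2 i, i \in D1 & exists2 p, open_rect c p & closed_rect i.2 p).
  apply: skip; case: (new1 i iD1) => [iD|[a aC e]].
    by constructor 3; exists i => //; exists p.
  constructor 1; have [a1 a2 _] := posC a (CC a aC).
  suff -> : c = a by apply/mapP; exists i.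
  apply: (sepC c a p) => //; first exact: CC.
  by apply: (shrink_subset d0) => //; rewrite -e.
have [Hf1 out1 hD1] := st1.
have [f' [g' [r [Hf' mv hr rE]]]] := fill_rect Hf1 dE w1 w2 hd.
exists f', g', ((r, shrink delta c) :: D1); split.
- split=> //.
  + move=> p no; rewrite -[RHS](out1 p no); case: (mv p) => [//|[a _]].
    suff : in_box M p by move/no.
    by rewrite -(out1 p no); exact: boxc.
  + move=> i; rewrite in_cons => /orP [/eqP ->|iD1].
      split=> //= p /shrink_subset hp Fp; apply: noF; exists p => //.
      by have [] := hp d0 w1 w2; split; exact: ltW.
    (* The map changes only at points whose image lies in the open cell, and the image rectangle of
       [i] misses it. *)
    have [hi h1 h2] := hD1 i iD1; split=> //.
    have [l [l0 w e Ef]] := hi; exists l; split=> // p hp; rewrite -Ef //.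
    case: (mv p) => [//|[a _]]; case: nomeet; exists i => //; exists (f1 p) => //.
    exact: homothetic_closed hi hp.
- by move=> i /sub1 h; rewrite in_cons h orbT.
- move=> p; case: (mv1 p) => [e1|[a aC [a1 a2]]]; case: (mv p) => [e|[b1 b2]].
  + by left; rewrite e.
  + by right; exists c => //; rewrite -e1.
  + by right; exists a; rewrite ?e //; exact: CC.
  + right; exists c => //; split=> //.
    by rewrite (sepC c a (f1 p) cC (CC a aC) b1 a2).
- move=> i; rewrite in_cons => /orP [/eqP ->|/new1 [|[a aC e]]].
  + by right; exists c.
  + by left.
  + by right; exists a => //; exact: CC.
- move=> a; rewrite in_cons => /orP [/eqP ->|/cov1 [h|h|h]].
  + by constructor 1; rewrite /= mem_head.
  + by constructor 1; rewrite /= in_cons h orbT.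
  + by constructor 2.
  + by constructor 3.
Qed.

Definition consecutive xs (a b : R) :=
  (a < b) && all (fun x => ~~ (a < x < b)) xs.

(** Taken from all pairs, so the list may be unsorted and contain repetitions. *)
Definition gaps xs : seq (R * R) :=
  [seq ab <- [seq (a, b) | a <- xs, b <- xs] | consecutive xs ab.1 ab.2].

Lemma gapsP xs (a b : R) : reflect
  [/\ a \in xs, b \in xs, a < b & forall x, x \in xs -> ~ (a < x /\ x < b)]
  ((a, b) \in gaps xs).
Proof.
rewrite mem_filter /consecutive /=; apply: (iffP idP).
  move=> /andP [/andP [lt /allP h] /allpairsP [[x y] [/= hx hy [ea eb]]]].
  move: hx hy; rewrite -ea -eb => ha hb.
  by split=> // z /h /negP hz [z1 z2]; apply: hz; rewrite z1 z2.
move=> [ha hb lt h]; rewrite lt /=; apply/andP; split.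
  by apply/allP => x /h hx; apply/negP => /andP.
by apply/allpairsP; exists (a, b).
Qed.

(** Starting from (a, b), the elements are inserted one by one; each that falls inside the current
    interval cuts it, and the part containing [x] is kept. *)
Lemma gaps_cover xs (a b x : R) : a \in xs -> b \in xs -> a < b -> a <= x <= b ->
  exists a' b', [/\ (a', b') \in gaps xs, a' <= x & x <= b'].
Proof.
move=> ha hb lt hx.
suff [a' [b' [ha' hb' lt' [h1 h2] no]]] : exists a' b',
    [/\ a' \in xs, b' \in xs, a' < b', a' <= x /\ x <= b' &
      forall y, y \in xs -> ~ (a' < y /\ y < b')].
  by exists a', b'; split=> //; apply/gapsP.
suff : forall zs : seq R, {subset zs <= xs} -> exists a' b',
    [/\ a' \in xs, b' \in xs, a' < b', a' <= x /\ x <= b' &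
      forall y, y \in zs -> ~ (a' < y /\ y < b')].
  by apply.
elim=> [|z zs IH] sub; first by exists a, b; split=> //; apply/andP.
have [|a' [b' [ha' hb' lt' [h1 h2] no]]] := IH.
  by move=> y hy; apply: sub; rewrite in_cons hy orbT.
have hz : z \in xs by apply: sub; rewrite mem_head.
have [[z1 z2]|nz] := pselect (a' < z /\ z < b'); last first.
  exists a', b'; split=> // y; rewrite in_cons => /orP [/eqP ->|/no] //.
have [le|/ltW le] := leP x z.
  exists a', z; split=> // y; rewrite in_cons => /orP [/eqP -> [_]|/no ny [y1 y2]].
    by rewrite ltxx.
  by apply: ny; split=> //; exact: lt_trans z2.
exists z, b'; split=> // y; rewrite in_cons => /orP [/eqP -> []|/no ny [y1 y2]].
  by rewrite ltxx.
by apply: ny; split=> //; exact: lt_trans y1.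
Qed.

Lemma gaps_inj xs (a b a' b' x : R) : (a, b) \in gaps xs -> (a', b') \in gaps xs ->
  a < x -> x < b -> a' < x -> x < b' -> (a, b) = (a', b').
Proof.
move=> /gapsP [ha hb lt no] /gapsP [ha' hb' lt' no'] h1 h2 h3 h4.
have := no a' ha'; have := no b' hb'; have := no' a ha; have := no' b hb.
move=> n1 n2 n3 n4; congr (_, _).
  case: (ltgtP a a') => // h; first by case: n4; split=> //; exact: lt_trans h2.
  by case: n2; split=> //; exact: lt_trans h4.
case: (ltgtP b b') => // h; first by case: n1; split=> //; exact: lt_trans h2.
by case: n3; split=> //; exact: lt_trans h4.
Qed.

Definition cell (I J : R * R) : rect :=
  (((I.1 + I.2) / 2, (J.1 + J.2) / 2), ((I.2 - I.1) / 2, (J.2 - J.1) / 2)).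

Lemma open_cell I J p : open_rect (cell I J) p <->
  [/\ I.1 < p.1, p.1 < I.2, J.1 < p.2 & p.2 < J.2].
Proof.
rewrite /open_rect /= !ltr_norml; split.
  by move=> [/andP [? ?] /andP [? ?]]; split; lra.
by move=> [? ? ? ?]; split; apply/andP; split; lra.
Qed.

Lemma closed_cell I J p : closed_rect (cell I J) p <->
  [/\ I.1 <= p.1, p.1 <= I.2, J.1 <= p.2 & p.2 <= J.2].
Proof.
rewrite /closed_rect /= !ler_norml; split.
  by move=> [/andP [? ?] /andP [? ?]]; split; lra.
by move=> [? ? ? ?]; split; apply/andP; split; lra.
Qed.

Definition cells xs ys : seq rect := [seq cell u v | u <- gaps xs, v <- gaps ys].

Lemma cells_separated xs ys : separated (cells xs ys).
Proof.
move=> c c' p /allpairsP [[[a b] [a' b']] [/= h1 h2 ->]].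
move=> /allpairsP [[[d e] [d' e']] [/= k1 k2 ->]].
move=> /open_cell [/= ? ? ? ?] /open_cell [/= ? ? ? ?].
by rewrite (@gaps_inj xs a b d e p.1) // (@gaps_inj ys a' b' d' e' p.2).
Qed.

Definition ticks (M h : R) (N : nat) : seq R := [seq - M + h * k%:R | k <- iota 0 N.+1].

Lemma ticksP (M h : R) N (a : R) : 0 < h -> - M <= a -> a < - M + h * N%:R ->
  exists2 x, x \in ticks M h N & a < x /\ x <= a + h.
Proof.
move=> h0 aM; elim: N => [|N IH]; first by rewrite mulr0 addr0; lra.
have [lt _|le lt] := ltP a (- M + h * N%:R).
  have [x /mapP [k hk ->] hx] := IH lt; exists (- M + h * k%:R) => //.
  by apply/mapP; exists k => //; move: hk; rewrite !mem_iota /= !add0n => /ltn_trans ->.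
exists (- M + h * N.+1%:R).
  by apply/mapP; exists N.+1 => //; rewrite mem_iota /= add0n.
by split=> //; rewrite -natr1; lra.
Qed.

(** A box-counting condition: finitely many balls of one common radius. The same [eta] bounds the
    radius and the total s-dimensional size. *)
Definition coverable (s eta : R) (A : pt -> Prop) := exists (cs : seq pt) (r : R),
  [/\ 0 < r, r <= eta, forall p, A p -> exists2 c, c \in cs & dist1 p c < r &
    (size cs)%:R * r `^ s <= eta].

Lemma coverable_sub (s eta : R) (A B : pt -> Prop) : (forall p, A p -> B p) ->
  coverable s eta B -> coverable s eta A.
Proof.
by move=> AB [cs [r [r0 le cov sz]]]; exists cs, r; split=> // p /AB /cov.
Qed.

Lemma coverable_le (s eta eta' : R) (A : pt -> Prop) : eta <= eta' ->
  coverable s eta A -> coverable s eta' A.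
Proof.
move=> le [cs [r [r0 le1 cov sz]]]; exists cs, r.
by split=> //; exact: le_trans le.
Qed.

Definition near_lines (M delta : R) xs ys p := in_box M p /\
  ((exists2 x, x \in xs & `|p.1 - x| <= delta) \/
   (exists2 y, y \in ys & `|p.2 - y| <= delta)).

(** Each line needs a number of balls proportional to M / r, so the cost is a constant times
    r^(s-1), small because s > 1. The width [delta] is the spacing of the centres. *)
Lemma near_lines_coverable (M s eta : R) xs ys : 0 < M -> 1 < s -> 0 < eta ->
  exists2 delta, 0 < delta & coverable s eta (near_lines M delta xs ys).
Proof.
move=> M0 s1 eta0.
pose m : R := (size xs + size ys)%:R.
have m0 : 0 <= m by rewrite /m ler0n.
(* Each line carries k + 1 <= 2 k balls of radius r = 3 h with h k = 2 M, so (k + 1) r <= 12 M; the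
   1 keeps [W] positive when there are no lines. *)
pose W := 12 * m * M + 1.
have W0 : 0 < W by rewrite /W; nra.
have s10 : 0 < s - 1 by lra.
have [rho [rho0 rho1 rho2]] : exists rho : R, [/\ 0 < rho, rho <= eta &
    rho <= (eta / W) `^ (s - 1)^-1].
  exists (Num.min eta ((eta / W) `^ (s - 1)^-1)).
  by rewrite lt_min eta0 powR_gt0 ?divr_gt0 // !ge_min !lexx orbT.
pose k := (Num.bound (6 * M / rho)).+1.
have k0 : (0 : R) < k%:R by rewrite ltr0n.
pose h := 2 * M / k%:R.
have h0 : 0 < h by apply: divr_gt0 => //; lra.
have hk : h * k%:R = 2 * M by rewrite /h divfK // gt_eqF.
(* A point is within [h] of a line and within [h] of a tick along it, hence at distance at most 2 h
   < r from a centre. *)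
pose r := 3 * h.
have r0 : 0 < r by rewrite /r; lra.
have rrho : r <= rho.
  have b0 : 0 <= 6 * M / rho by apply: divr_ge0; lra.
  have := archi_boundP b0; rewrite ltr_pdivrMr // => lt.
  rewrite -(ler_pM2r k0) /r -mulrA hk.
  have : (Num.bound (6 * M / rho))%:R <= k%:R :> R by rewrite ler_nat.
  by move/(ler_wpM2l (ltW rho0)); lra.
have [r_eta r_pow] : r <= eta /\ r <= (eta / W) `^ (s - 1)^-1.
  by split; exact: le_trans rrho _.
have rs : r `^ (s - 1) <= eta / W.
  have -> : eta / W = ((eta / W) `^ (s - 1)^-1) `^ (s - 1).
    by rewrite -powRrM mulVf ?gt_eqF // powRr1 // divr_ge0 // ltW.
  by apply: ge0_ler_powR => //; rewrite ?nnegrE ?powR_ge0 // ltW.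
have hit (t : R) : `|t| <= M -> exists2 x, x \in ticks M h k & `|t - x| <= h.
  rewrite ler_norml => /andP [t1 t2].
  have [lt|le] := ltP t M.
    have [|x hx [x1 x2]] := @ticksP M h k t h0 t1; first by rewrite hk; lra.
    by exists x => //; rewrite ler_norml; apply/andP; split; lra.
  exists (- M + h * k%:R).
    by apply/mapP; exists k => //; rewrite mem_iota add0n leqnn.
  by rewrite hk ler_norml; apply/andP; split; lra.
exists h => //.
exists ([seq (x, t) | x <- xs, t <- ticks M h k] ++
        [seq (t, y) | t <- ticks M h k, y <- ys]), r; split=> //.
  move=> p [[b1 b2] [[x hx hp]|[y hy hp]]].
    have [t ht tp] := hit p.2 b2; exists (x, t).
      by rewrite mem_cat; apply/orP; left; apply/allpairsP; exists (x, t).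
    by rewrite /dist1 /= /r; lra.
  have [t ht tp] := hit p.1 b1; exists (t, y).
    by rewrite mem_cat; apply/orP; right; apply/allpairsP; exists (t, y).
  by rewrite /dist1 /= /r; lra.
rewrite size_cat !size_allpairs size_map size_iota [(k.+1 * _)%N]mulnC -mulnDl.
rewrite natrM -/m.
rewrite -mulr_powRB1 ?(ltW r0) //; last lra.
have k1 : k.+1%:R <= 2 * k%:R :> R.
  have : (1 : R) <= k%:R by rewrite ler1n.
  by rewrite -natr1; lra.
have P0 : 0 <= r `^ (s - 1) by exact: powR_ge0.
have kr : k.+1%:R * r <= 12 * M.
  have : k.+1%:R * r <= 2 * k%:R * r by rewrite ler_pM2r.
  have -> : 2 * k%:R * r = 6 * (h * k%:R) by rewrite /r; ring.
  rewrite hk; lra.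
have WE : r `^ (s - 1) * W <= eta by rewrite -ler_pdivlMr.
have : m * k.+1%:R * (r * r `^ (s - 1)) <= m * (12 * M) * r `^ (s - 1).
  have -> : m * k.+1%:R * (r * r `^ (s - 1)) =
    m * r `^ (s - 1) * (k.+1%:R * r) by ring.
  have -> : m * (12 * M) * r `^ (s - 1) = m * r `^ (s - 1) * (12 * M) by ring.
  by apply: ler_wpM2l => //; exact: mulr_ge0.
move/le_trans; apply; apply: le_trans WE; rewrite /W; lra.
Qed.

Definition live (M : R) (C : seq rect) p :=
  in_box M p /\ forall c, c \in C -> ~ open_rect c p.

(** Ticks of step [h] bound the gaps, and adding the prescribed values [vs] (the sides of the
    present rectangles) keeps them out of the interiors of gaps. *)
Lemma grid_exists (M h : R) (vs : seq R) : 0 < M -> 0 < h -> exists zs : seq R,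
  [/\ forall t, `|t| <= M -> exists2 u, u \in gaps zs & u.1 <= t /\ t <= u.2,
    forall u, u \in gaps zs -> [/\ u.1 \in zs, u.2 \in zs, u.1 < u.2,
      u.2 - u.1 <= h & - M <= u.1 /\ u.2 <= M] &
    forall u v, u \in gaps zs -> v \in vs -> ~ (u.1 < v /\ v < u.2)].
Proof.
move=> M0 h0.
pose N := Num.bound (2 * M / h).
have hN : 2 * M < h * N%:R.
  have b0 : 0 <= 2 * M / h by apply: divr_ge0; lra.
  by have := archi_boundP b0; rewrite ltr_pdivrMr // [_ * h]mulrC.
pose ws := (- M) :: M :: ticks M h N ++ vs.
pose zs := [seq x <- ws | `|x| <= M].
have inz x : x \in ws -> `|x| <= M -> x \in zs.
  by move=> h1 h2; rewrite mem_filter h2.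
have zM x : x \in zs -> - M <= x <= M.
  by rewrite mem_filter -ler_norml => /andP [].
have gapM u : u \in gaps zs -> - M <= u.1 /\ u.2 <= M.
  by case: u => a b /gapsP [/zM /andP [? _] /zM /andP [_ ?] _ _]; split.
exists zs; split.
- move=> t tM; have [||||a [b [hu a1 b1]]] := @gaps_cover zs (- M) M t.
  + by apply: inz; rewrite ?mem_head // normrN gtr0_norm.
  + by apply: inz; rewrite ?gtr0_norm // /ws 2!in_cons eqxx orbT.
  + lra.
  + by rewrite -ler_norml.
  by exists (a, b).
- case=> a b hu; have [m1 m2] := gapM _ hu; rewrite /= in m1 m2.
  have /gapsP [ha hb lt no] := hu; split=> //=.
  rewrite leNgt; apply/negP => gap.
  have [|x hx [x1 x2]] := @ticksP M h N a h0 m1; first lra.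
  apply: (no x); last by split=> //; lra.
  apply: inz; first by rewrite /ws 2!in_cons mem_cat hx !orbT.
  by rewrite ler_norml; apply/andP; split; lra.
case=> a b v hu hv; have [m1 m2] := gapM _ hu; rewrite /= in m1 m2.
have /gapsP [_ _ _ no] := hu; move=> /= -[v1 v2].
apply: (no v) => //; apply: inz; first by rewrite /ws 2!in_cons mem_cat hv !orbT.
by rewrite ler_norml; apply/andP; split; lra.
Qed.

Lemma dist_le_length (a b h x y : R) : a <= x -> x <= b -> a <= y -> y <= b ->
  b - a <= h -> `|x - y| <= h.
Proof. by move=> *; rewrite ler_norml; apply/andP; split; lra. Qed.

Lemma outside_shrunk (delta a b d h x : R) : 0 < delta -> a < b -> b - a <= h ->
  delta * h <= d -> a <= x -> x <= b ->
  (1 - delta) * ((b - a) / 2) <= `|x - (a + b) / 2| -> `|x - a| <= d \/ `|x - b| <= d.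
Proof.
move=> d0 ab bh dh ax xb.
have : delta * (b - a) <= d by apply: le_trans dh; rewrite ler_pM2l.
have -> : (1 - delta) * ((b - a) / 2) = (b - a) / 2 - delta * (b - a) / 2 by ring.
have : 0 < delta * (b - a) by rewrite mulr_gt0 // subr_gt0.
move: (delta * (b - a)) => e e0 ed.
rewrite ler_normr => /orP [n|n].
  by right; rewrite ler_norml; apply/andP; split; lra.
by left; rewrite ler_norml; apply/andP; split; lra.
Qed.

(** An interval that meets the interior of a gap but has no endpoint there contains the whole
    gap. *)
Lemma between_or_end (m w a b x z : R) : a < z -> z < b -> `|z - m| <= w ->
  ~ (a < m - w /\ m - w < b) -> ~ (a < m + w /\ m + w < b) ->
  a <= x -> x <= b -> [\/ x = a, x = b | `|x - m| < w].
Proof.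
move=> az zb; rewrite ler_norml => /andP [z1 z2] no1 no2 ax xb.
have le1 : m - w <= a.
  by rewrite leNgt; apply/negP => lt; apply: no1; split=> //; lra.
have le2 : b <= m + w.
  by rewrite leNgt; apply/negP => lt; apply: no2; split=> //; lra.
have [n1|n1] := ltP a x; last by constructor 1; lra.
have [n2|n2] := ltP x b; last by constructor 2; lra.
by constructor 3; rewrite ltr_norml; apply/andP; split; lra.
Qed.

Lemma fill_step M s eta E F f g D : 0 < M -> 1 < s -> 0 < eta ->
  dense_balls (fun p r => forall q, dist1 p q < r -> ~ E q) ->
  stage M E F f g D ->
  exists f' g' D', [/\ stage M E F f' g' D', {subset D <= D'},
    forall p, dist1 (f' p) (f p) <= eta,
    forall p, dist1 (g' p) (g p) <= eta &
    coverable s eta (fun p => live M (map snd D') p /\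
      forall e, F e -> eta <= dist1 p e)].
Proof.
move=> M0 s1 eta0 dE st.
have [[fg gf _ [C C0 Lg] _] out hD] := st.
(* Images move by at most 2 h within a cell. Since [g' y] equals [g (f (g' y))], while y is
   [f' (g' y)], the inverse moves by at most C times that. *)
have [h [h0 h2 Ch]] : exists h : R, [/\ 0 < h, h + h < eta & C * (h + h) <= eta].
  exists (eta / (4 * (1 + C))); split; first by apply: divr_gt0 => //; lra.
    by rewrite -mulrDl ltr_pdivrMr; nra.
  by rewrite -mulrDl mulrA ler_pdivrMr; nra.
have [xs [covx gapx deadx]] := grid_exists
  ([seq i.2.1.1 - i.2.2.1 | i <- D] ++ [seq i.2.1.1 + i.2.2.1 | i <- D]) M0 h0.
have [ys [covy gapy deady]] := grid_exists
  ([seq i.2.1.2 - i.2.2.2 | i <- D] ++ [seq i.2.1.2 + i.2.2.2 | i <- D]) M0 h0.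
have [dl dl0 cov] := @near_lines_coverable M s eta xs ys M0 s1 eta0.
(* The tolerance [dl] depends on the number of grid lines, so the shrinking factor is fixed after
   the grid: the frame left in a filled cell is then within [dl] of its sides. *)
pose delta := Num.min (1 / 2) (dl / h).
have delta0 : 0 < delta by rewrite lt_min; apply/andP; split; exact: divr_gt0.
have [delta1 delta2] : delta <= 1 / 2 /\ delta * h <= dl.
  by rewrite -ler_pdivlMr // /delta !ge_min !lexx orbT.
have cellP c : c \in cells xs ys -> exists u v,
    [/\ u \in gaps xs, v \in gaps ys & c = cell u v].
  by move=> /allpairsP [[u v] [/= ? ? ->]]; exists u, v.
have [||f' [g' [D' [st' sub mv new covD]]]] :=
  @fill_cells M E F delta (cells xs ys) f g D _ dE (@cells_separated xs ys) _ st.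
- by rewrite delta0.
- move=> _ /cellP [u [v [/gapx [_ _ lt1 _ [i1 i2]] /gapy [_ _ lt2 _ [j1 j2]] ->]]].
  split=> [/=|/=|p /open_cell [p1 p2 p3 p4]]; try by rewrite divr_gt0 // subr_gt0.
  split; rewrite ler_norml; apply/andP; split.
  - exact: le_trans i1 (ltW p1).
  - exact: le_trans (ltW p2) i2.
  - exact: le_trans j1 (ltW p3).
  - exact: le_trans (ltW p4) j2.
have close p : dist1 (f' p) (f p) <= h + h.
  case: (mv p) => [->|]; first by rewrite dist1xx ltW // addr_gt0.
  move=> [_ /cellP [u [v [/gapx [_ _ _ i _] /gapy [_ _ _ j _] ->]]]].
  move=> [/open_cell [? ? ? ?] /open_cell [? ? ? ?]]; apply: lerD.
    by apply: (dist_le_length _ _ _ _ i); exact: ltW.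
  by apply: (dist_le_length _ _ _ _ j); exact: ltW.
exists f', g', D'; split=> //.
- by move=> p; exact: le_trans (close p) (ltW h2).
- move=> y; case: st' => [[fg' gf' _ _ _] _ _].
  have := Lg (f' (g' y)) (f (g' y)); rewrite fg gf' dist1C => hy.
  apply: le_trans hy (le_trans _ Ch).
  by rewrite ler_pM2l // -{1}(gf' y) close.
apply: coverable_sub cov => p [[[b1 b2] hl] far]; split=> //.
have [u hu [u1 u2]] := covx p.1 b1; have [v hv [v1 v2]] := covy p.2 b2.
have [x1 x2 ltu hul _] := gapx u hu; have [y1 y2 ltv hvl _] := gapy v hv.
have : cell u v \in cells xs ys by apply/allpairsP; exists (u, v).
(* In a filled cell a live point lies in the thin frame; a cell meeting [F] has diameter below [eta]
   and is excluded by [far]; a cell meeting an old rectangle lies in it, so its live points are on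
   grid lines. *)
case/covD => [hs|[e /closed_cell [? ? ? ?] Fe]|[i iD [z /open_cell [z1 z2 z3 z4] zi]]].
- have nin := hl _ hs.
  have [n1|n1] := ltP `|p.1 - (u.1 + u.2) / 2| ((1 - delta) * ((u.2 - u.1) / 2)).
    have [n2|n2] := ltP `|p.2 - (v.1 + v.2) / 2| ((1 - delta) * ((v.2 - v.1) / 2)).
      by case: nin.
    right; have [?|?] := outside_shrunk delta0 ltv hvl delta2 v1 v2 n2.
      by exists v.1.
    by exists v.2.
  left; have [?|?] := outside_shrunk delta0 ltu hul delta2 u1 u2 n1.
    by exists u.1.
  by exists u.2.
- have := far e Fe; rewrite leNgt => /negP; case; apply: le_lt_trans h2.
  apply: lerD; first exact: (dist_le_length _ _ _ _ hul).
  exact: (dist_le_length _ _ _ _ hvl).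
have nin : ~ open_rect i.2 p by apply: hl; apply: map_f; exact: sub.
have xi (w : R) : w \in [seq i.2.1.1 - i.2.2.1 | i <- D] ++
    [seq i.2.1.1 + i.2.2.1 | i <- D] -> ~ (u.1 < w /\ w < u.2) by exact: deadx.
have yi (w : R) : w \in [seq i.2.1.2 - i.2.2.2 | i <- D] ++
    [seq i.2.1.2 + i.2.2.2 | i <- D] -> ~ (v.1 < w /\ w < v.2) by exact: deady.
have dlE (t : R) : `|t - t| <= dl by rewrite subrr normr0 ltW.
case: zi => zi1 zi2.
have [||e|e|in1] := between_or_end z1 z2 zi1 _ _ u1 u2.
- by apply: xi; rewrite mem_cat; apply/orP; left; apply/mapP; exists i.
- by apply: xi; rewrite mem_cat; apply/orP; right; apply/mapP; exists i.
- by left; exists u.1; rewrite // e.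
- by left; exists u.2; rewrite // e.
have [||e|e|in2] := between_or_end z3 z4 zi2 _ _ v1 v2.
- by apply: yi; rewrite mem_cat; apply/orP; left; apply/mapP; exists i.
- by apply: yi; rewrite mem_cat; apply/orP; right; apply/mapP; exists i.
- by right; exists v.1; rewrite // e.
- by right; exists v.2; rewrite // e.
by case: nin.
Qed.

(** The second call acts on the inverse with the avoided sets exchanged, so only cells disjoint from
    [E] are filled. The range bound of the first call persists, since adding items only shrinks the
    live set. *)
Lemma two_sided_step M s eta E f g D : 0 < M -> 1 < s -> 0 < eta ->
  dense_balls (fun p r => forall q, dist1 p q < r -> ~ E q) ->
  stage M E (fun=> False) f g D ->
  exists f' g' D', [/\ stage M E (fun=> False) f' g' D', {subset D <= D'},
    forall p, dist1 (f' p) (f p) <= eta /\ dist1 (g' p) (g p) <= eta,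
    coverable s eta (live M (map snd D')) &
    coverable s eta (fun p => live M (map fst D') p /\
      forall e, E e -> eta <= dist1 p e)].
Proof.
move=> M0 s1 eta0 dE st.
have eta20 : 0 < eta / 2 by lra.
have [f1 [g1 [D1 [st1 sub1 df1 dg1 cov1]]]] := fill_step M0 s1 eta20 dE st.
have dF : dense_balls (fun p (r : R) => forall q : pt, dist1 p q < r -> ~ False).
  by move=> p r r0; exists p, r; rewrite dist1xx add0r; split=> // q _ [].
have [g2 [f2 [D2 [st2 sub2 dg2 df2 cov2]]]] :=
  fill_step M0 s1 eta20 dF (stage_swap st1).
have subD : {subset D1 <= map swap_item D2}.
  by rewrite -{1}(map_swapK D1) => i /mapP [j /sub2 hj ->]; exact: map_f.
have tri (a b c : pt) : dist1 a b <= eta / 2 -> dist1 b c <= eta / 2 ->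
    dist1 a c <= eta.
  by move=> h1 h2; have := dist1_triangle b a c; lra.
have weak (A : pt -> Prop) : coverable s (eta / 2) A -> coverable s eta A.
  by apply: coverable_le; lra.
exists f2, g2, (map swap_item D2); split.
- exact: stage_swap st2.
- by move=> i /sub1 /subD.
- by move=> p; split; [apply: tri (df2 p) (df1 p) | apply: tri (dg2 p) (dg1 p)].
- apply/weak/(coverable_sub _ cov1) => p [hb hl]; split=> //; split=> // c.
  by move=> /mapP [i /subD hi ->]; apply: hl; exact: map_f.
- apply/weak/(coverable_sub _ cov2) => p [[hb hl] far]; split.
    split=> // c hc; apply: hl; rewrite -map_comp.
    by case/mapP: hc => i hi ->; apply/mapP; exists i.
  by move=> e /far; lra.
Qed.

End Fill.

(** * The limit homeomorphism *)

Section Limit.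
Context {R : realType}.
Notation pt := (R * R)%type.
Notation rect := ((R * R) * (R * R))%type.
Implicit Types (p q : pt) (f g : pt -> pt) (E : pt -> Prop).

Lemma half_pow_gt0 n : 0 < (1 / 2 : R) ^+ n.
Proof. by apply: exprn_gt0; lra. Qed.

Lemma half_powS n : (1 / 2 : R) ^+ n.+1 = (1 / 2) ^+ n / 2.
Proof. by rewrite exprS mulrC; congr (_ * _); lra. Qed.

Lemma half_pow_le m n : (m <= n)%N -> (1 / 2 : R) ^+ n <= (1 / 2) ^+ m.
Proof.
elim: n => [|n IH]; first by rewrite leqn0 => /eqP ->.
rewrite leq_eqVlt => /orP [/eqP -> //|/IH le].
by rewrite half_powS; have := half_pow_gt0 n; lra.
Qed.

Lemma half_pow_small (e : R) : 0 < e -> exists n, (1 / 2) ^+ n < e.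
Proof.
move=> e0; exists (Num.bound e^-1).
have b0 : 0 <= e^-1 by rewrite invr_ge0 ltW.
have := archi_boundP b0; set n := Num.bound _ => lt.
have : (n%:R : R) < 2 ^+ n by rewrite -natrX ltr_nat ltn_expl.
move=> /(lt_trans lt) lt2.
rewrite div1r exprVn -(invrK e) ltf_pV2 // posrE ?invr_gt0 // exprn_gt0 //; lra.
Qed.

(** The intervals of radius 2^-n about [u n] are nested; the supremum of their left ends lies in all
    of them. *)
Lemma geometric_limit (u : nat -> R) :
  (forall n, `|u n.+1 - u n| <= (1 / 2) ^+ n.+1) ->
  exists l, forall n, `|u n - l| <= (1 / 2) ^+ n.
Proof.
move=> hu.
have step n : u n - (1 / 2) ^+ n <= u n.+1 - (1 / 2) ^+ n.+1 /\
    u n.+1 + (1 / 2) ^+ n.+1 <= u n + (1 / 2) ^+ n.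
  by have := hu n; rewrite half_powS ler_norml => /andP [? ?]; split; lra.
have lo m k : u m - (1 / 2) ^+ m <= u (m + k)%N - (1 / 2) ^+ (m + k).
  elim: k => [|k IH]; first by rewrite addn0.
  by rewrite addnS; apply: (le_trans IH); case: (step (m + k)%N).
have up m k : u (m + k)%N + (1 / 2) ^+ (m + k) <= u m + (1 / 2) ^+ m.
  elim: k => [|k IH]; first by rewrite addn0.
  by rewrite addnS; apply: le_trans IH; case: (step (m + k)%N).
have lu m n : u m - (1 / 2) ^+ m <= u n + (1 / 2) ^+ n.
  have [le|/ltnW le] := leqP m n.
    have := lo m (n - m)%N; rewrite subnKC // => h.
    by have := half_pow_gt0 n; lra.
  have := up n (m - n)%N; rewrite subnKC // => h.
  by have := half_pow_gt0 m; lra.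
pose A := range (fun n => u n - (1 / 2) ^+ n).
have A0 : A !=set0 by exists (u 0%N - (1 / 2) ^+ 0), 0%N.
have Aub n : ubound A (u n + (1 / 2) ^+ n) by move=> _ [m _ <-]; exact: lu.
exists (sup A) => n.
have h1 : u n - (1 / 2) ^+ n <= sup A.
  by apply: ub_le_sup; [exists (u 0%N + (1 / 2) ^+ 0) | exists n].
have h2 : sup A <= u n + (1 / 2) ^+ n by exact: ge_sup.
by rewrite ler_norml; apply/andP; split; lra.
Qed.

Lemma dist1_geometric_limit (f : nat -> pt -> pt) :
  (forall n p, dist1 (f n.+1 p) (f n p) <= (1 / 2) ^+ n.+1) ->
  exists F : pt -> pt, forall n p, dist1 (f n p) (F p) <= 2 * (1 / 2) ^+ n.
Proof.
move=> hf.
have lim p : exists l : pt, forall n, dist1 (f n p) l <= 2 * (1 / 2) ^+ n.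
  have [|a ha] := @geometric_limit (fun n => (f n p).1).
    move=> n; apply: le_trans (hf n p); rewrite /dist1.
    by have := normr_ge0 ((f n.+1 p).2 - (f n p).2); lra.
  have [|b hb] := @geometric_limit (fun n => (f n p).2).
    move=> n; apply: le_trans (hf n p); rewrite /dist1.
    by have := normr_ge0 ((f n.+1 p).1 - (f n p).1); lra.
  by exists (a, b) => n; have := ha n; have := hb n; rewrite /dist1 /=; lra.
by have [F hF] := choice lim; exists F => n p; exact: hF.
Qed.

Definition uniform1 f := forall e : R, 0 < e -> exists2 d, 0 < d &
  forall p q, dist1 p q < d -> dist1 (f p) (f q) < e.

Section UniformLimit.
Context (f : nat -> pt -> pt) (F : pt -> pt).
Hypothesis fF : forall n p, dist1 (f n p) (F p) <= 2 * (1 / 2) ^+ n.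

Lemma limit_close (e : R) : 0 < e -> exists n, forall p, dist1 (f n p) (F p) < e.
Proof.
move=> e0; have [|n hn] := @half_pow_small (e / 2); first lra.
by exists n => p; have := fF n p; lra.
Qed.

Lemma limit_uniform : (forall n, lipschitz1 (f n)) -> uniform1 F.
Proof.
move=> Lf e e0; have [|n hn] := @limit_close (e / 4); first lra.
have [C C0 hC] := Lf n; exists (e / (2 * C)); first by apply: divr_gt0; lra.
move=> p q; rewrite ltr_pdivlMr; last lra.
have := hn p; have := hn q; have := hC p q.
have := dist1_triangle (f n p) (F p) (F q).
have := dist1_triangle (f n q) (f n p) (F q).
rewrite (dist1C (F p) (f n p)); nra.
Qed.

Lemma limit_constant p c n : (forall m, (n <= m)%N -> f m p = c) -> F p = c.
Proof.
move=> hc; apply/esym/dist1_eq0/eqP; rewrite eq_le dist1_ge0 andbT leNgt.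
apply/negP => pos.
have [|k hk] := @half_pow_small (dist1 c (F p) / 2); first lra.
have := fF (maxn n k) p; rewrite hc ?leq_maxl //.
by have := half_pow_le (leq_maxr n k); lra.
Qed.

End UniformLimit.

(** G (F p) is close to G (f_k p) by uniform continuity, and that is close to g_k (f_k p) = p. *)
Lemma limit_cancel (f g : nat -> pt -> pt) (F G : pt -> pt) :
  (forall n p, dist1 (f n p) (F p) <= 2 * (1 / 2) ^+ n) ->
  (forall n p, dist1 (g n p) (G p) <= 2 * (1 / 2) ^+ n) ->
  (forall n, cancel (f n) (g n)) -> uniform1 G -> cancel F G.
Proof.
move=> fF gG fg uG p; apply/dist1_eq0/eqP; rewrite eq_le dist1_ge0 andbT leNgt.
apply/negP => pos; set e := dist1 _ _ in pos.
have e20 : 0 < e / 2 by lra.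
have [d d0 hd] := uG _ e20.
have [|k hk] := @half_pow_small (Num.min (d / 2) (e / 4)).
  by rewrite lt_min; apply/andP; split; lra.
move: hk; rewrite lt_min => /andP [k1 k2].
have h1 : dist1 (G (F p)) (G (f k p)) < e / 2.
  by apply: hd; rewrite dist1C; have := fF k p; lra.
have := gG k (f k p); rewrite fg.
by have := dist1_triangle (G (f k p)) (G (F p)) p;
  rewrite (dist1C p) -/e; lra.
Qed.

Lemma homothetic_eq f f' i p : homothetic f i -> homothetic f' i ->
  closed_rect i.1 p -> f p = f' p.
Proof.
move=> [l [l0 [w _] e El]] [l' [_ _ e' El']] hp; rewrite (El p hp) (El' p hp).
have -> // : l = l'.
have : l * i.1.2.1 = l' * i.1.2.1 by move: e'; rewrite e => -[].
by move/mulIf; apply; rewrite gt_eqF.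
Qed.

Theorem planar_limit (M s : R) E : 0 < M -> 1 < s ->
  dense_balls (fun p r => forall q, dist1 p q < r -> ~ E q) ->
  exists (F G : pt -> pt) (D : nat -> seq (rect * rect)),
  [/\ [/\ cancel F G, cancel G F, uniform1 F & uniform1 G],
    forall p, ~ in_box M p -> F p = p,
    forall n i, i \in D n -> homothetic F i /\ forall p, closed_rect i.1 p -> ~ E p,
    forall m n, (m <= n)%N -> {subset D m <= D n} &
    forall n, coverable s ((1 / 2) ^+ n) (live M (map snd (D n.+1))) /\
      coverable s ((1 / 2) ^+ n) (fun p => live M (map fst (D n.+1)) p /\
      forall e, E e -> (1 / 2) ^+ n <= dist1 p e)].
Proof.
move=> M0 s1 dE.
pose T := {x : (pt -> pt) * (pt -> pt) * seq (rect * rect) |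
  stage M E (fun=> False) x.1.1 x.1.2 x.2}.
(* The index is part of the argument so that the tolerance can depend on it; a choice function for
   this relation is then iterated. *)
pose follows (x : nat * T) (t : T) := let y := sval x.2 in let z := sval t in
    [/\ {subset y.2 <= z.2},
      forall p, dist1 (z.1.1 p) (y.1.1 p) <= (1 / 2) ^+ x.1.+1 /\
        dist1 (z.1.2 p) (y.1.2 p) <= (1 / 2) ^+ x.1.+1,
      coverable s ((1 / 2) ^+ x.1.+1) (live M (map snd z.2)) &
      coverable s ((1 / 2) ^+ x.1.+1) (fun p => live M (map fst z.2) p /\
        forall e, E e -> (1 / 2) ^+ x.1.+1 <= dist1 p e)].
have /choice [next hnext] : forall x, exists t, follows x t.
  move=> [n [[[f g] D] st]].
  have [f' [g' [D' [st' h1 h2 h3 h4]]]] :=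
    two_sided_step M0 s1 (half_pow_gt0 n.+1) dE st.
  by exists (exist _ (f', g', D') st').
have st0 : stage M E (fun=> False) id id [::].
  by split=> //; exact: pl_homeo_id.
pose x := fix x n : T := if n is k.+1 then next (k, x k)
  else exist _ (id, id, [::]) st0.
pose f n := (sval (x n)).1.1; pose g n := (sval (x n)).1.2.
pose D n := (sval (x n)).2.
have st n : stage M E (fun=> False) (f n) (g n) (D n) by exact: (svalP (x n)).
have step n := hnext (n, x n).
have [F fF] := @dist1_geometric_limit f (fun n p =>
  let: And4 _ h _ _ := step n in (h p).1).
have [G gG] := @dist1_geometric_limit g (fun n p =>
  let: And4 _ h _ _ := step n in (h p).2).
have hfg n : [/\ cancel (f n) (g n), cancel (g n) (f n), lipschitz1 (f n) &
    lipschitz1 (g n)] by have [[]] := st n.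
have uF : uniform1 F by apply: limit_uniform fF _ => n; case: (hfg n).
have uG : uniform1 G by apply: limit_uniform gG _ => n; case: (hfg n).
have subD m n : (m <= n)%N -> {subset D m <= D n}.
  elim: n => [|n IH]; first by rewrite leqn0 => /eqP ->.
  rewrite leq_eqVlt => /orP [/eqP -> //|/IH sub] i /sub hi.
  by have [h _ _ _] := step n; exact: h.
have hle n : (1 / 2 : R) ^+ n.+1 <= (1 / 2) ^+ n by exact: half_pow_le.
have weak n A : coverable s ((1 / 2) ^+ n.+1) A -> coverable s ((1 / 2) ^+ n) A.
  exact: coverable_le (hle n).
exists F, G, D; split=> //.
- split=> //.
    by apply: limit_cancel fF gG _ uG => n; case: (hfg n).
  by apply: limit_cancel gG fF _ uF => n; case: (hfg n).
- move=> p no; apply: (limit_constant fF (n := 0%N)) => m _.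
  by have [_ out _] := st m; exact: out.
- move=> n i hi; have [_ _ hD] := st n; have [hom hE _] := hD i hi.
  split=> //; have [l [l0 w e El]] := hom; exists l; split=> // p hp.
  (* The item stays in all later lists and determines the map on its source rectangle, so the
     sequence is constant there from stage [n] on. *)
  rewrite -El //; apply: (limit_constant fF (n := n)) => m le.
  have [_ _ hDm] := st m; have [hom' _ _] := hDm i (subD _ _ le _ hi).
  exact: homothetic_eq hom' hom hp.
- move=> n; have [_ _ c1 c2] := step n; split; first exact: weak.
  apply: weak; apply: coverable_sub c2 => p [hl far]; split=> // e /far.
  exact: le_trans (hle n).
Qed.

End Limit.

(** * Hausdorff measure and area *)

Section Size.
Context {R : realType}.
Notation pt := (R * R)%type.
Notation rect := ((R * R) * (R * R))%type.

Definition plane_of (z : cplane R) : pt := (complex.Re z, complex.Im z).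
Definition of_plane (p : pt) : cplane R := complex.Complex p.1 p.2.

Lemma plane_ofK : cancel plane_of of_plane. Proof. by case. Qed.
Lemma of_planeK : cancel of_plane plane_of. Proof. by case. Qed.

Lemma normc_le_dist1 (z w : cplane R) :
  Normc.normc (z - w) <= dist1 (plane_of z) (plane_of w).
Proof.
case: z w => [a b] [c d]; rewrite /dist1 /plane_of /=.
have key (x y : R) : x ^+ 2 + y ^+ 2 <= (`|x| + `|y|) ^+ 2.
  rewrite -(real_normK (num_real x)) -(real_normK (num_real y)).
  by have := normr_ge0 x; have := normr_ge0 y; nra.
by rewrite -[leRHS]ger0_norm ?addr_ge0 // -sqrtr_sqr ler_wsqrtr // key.
Qed.

Lemma proj_le_normc (z w : cplane R) :
  `|complex.Re z - complex.Re w| <= Normc.normc (z - w) /\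
  `|complex.Im z - complex.Im w| <= Normc.normc (z - w).
Proof.
case: z w => [a b] [c d] /=; rewrite -!sqrtr_sqr.
by split; apply: ler_wsqrtr; rewrite ?lerDl ?lerDr sqr_ge0.
Qed.

Lemma diam_ge0 (U : set (cplane R)) : (0 <= diam U)%E.
Proof. by rewrite /diam le_max lexx. Qed.

Definition plane_ball (c : pt) (r : R) : set (cplane R) :=
  [set z | dist1 (plane_of z) c < r].

Lemma diam_ball (c : pt) (r : R) : 0 <= r ->
  (diam (plane_ball c r) <= (2 * r)%:E)%E.
Proof.
move=> r0; rewrite /diam ge_max; apply/andP; split.
  by rewrite lee_fin mulr_ge0.
apply: ge_ereal_sup => _ [z [w [/= hz hw ->]]]; rewrite lee_fin.
apply: le_trans (normc_le_dist1 _ _) _.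
have := dist1_triangle c (plane_of z) (plane_of w).
by rewrite (dist1C c); move: hz hw; rewrite /plane_ball /=; lra.
Qed.

Lemma diam_set0 : diam (set0 : set (cplane R)) = 0%E.
Proof.
apply/eqP; rewrite eq_le diam_ge0 andbT /diam ge_max lexx /=.
by apply: ge_ereal_sup => x [z [w []]].
Qed.

(** The finite covers are padded by empty sets, which contribute nothing since their diameter is 0
    and s > 0. *)
Definition pair_cover (cs : nat -> seq pt) (r : nat -> R) (n j : nat) :
    set (cplane R) :=
  if (j < size (cs n))%N then plane_ball (nth (0, 0) (cs n) j) (r n) else set0.

Lemma pair_cover_sum (s : R) cs r n : 0 < s -> 0 < r n ->
  (\sum_(0 <= j <oo) (diam (pair_cover cs r n j) `^ s) <=
     ((size (cs n))%:R * (2 * r n) `^ s)%:E)%E.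
Proof.
move=> s0 r0.
have t0 j : (0 <= diam (pair_cover cs r n j) `^ s)%E by exact: poweR_ge0.
apply: lime_le; first by apply: is_cvg_nneseries => j _ _; exact: t0.
apply: nearW => N.
suff : (\sum_(0 <= j < N) (diam (pair_cover cs r n j) `^ s) <=
    ((minn N (size (cs n)))%:R * (2 * r n) `^ s)%:E)%E.
  move/le_trans; apply; rewrite lee_fin ler_wpM2r ?powR_ge0 //.
  by rewrite ler_nat geq_minr.
elim: N => [|N IH]; first by rewrite big_geq // min0n mul0r.
rewrite big_nat_recr //=; rewrite /pair_cover; case: ltnP => hN.
  have -> : minn N.+1 (size (cs n)) = (minn N (size (cs n))).+1.
    by rewrite (minn_idPl hN) (minn_idPl (ltnW hN)).
  rewrite -natr1 mulrDl mul1r EFinD; apply: leeD; first exact: IH.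
  rewrite -poweR_EFin; apply: gt0_ler_poweR => //.
  - exact: ltW.
  - by rewrite in_itv /= diam_ge0 leey.
  - by rewrite in_itv /= leey lee_fin mulr_ge0 // ltW.
  - by apply: diam_ball; exact: ltW.
rewrite diam_set0 poweR0r ?gt_eqF // adde0; apply: (le_trans IH).
by rewrite lee_fin ler_wpM2r ?powR_ge0 // ler_nat leq_min geq_minr andbT leqW ?geq_minl.
Qed.

(** Countable subadditivity by hand: the n-th set is covered at cost e / 2^(n+1), and the double
    family is enumerated by a bijection between naturals and pairs. *)
Lemma hausdorff_measure_eq0 (s : R) (A : nat -> pt -> Prop) (B : set (cplane R)) :
  0 < s -> (forall z, B z -> exists n, A n (plane_of z)) ->
  (forall n eta, 0 < eta -> coverable s eta (A n)) ->
  hausdorff_measure s B = 0%E.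
Proof.
move=> s0 BA cov.
have pre0 d : 0 < d -> hausdorff_premeasure s d B = 0%E.
  move=> d0; apply/eqP; rewrite eq_le; apply/andP; split; last first.
    apply: le_ereal_inf_tmp => _ [U [_ _ ->]].
    by apply: nneseries_ge0 => *; exact: poweR_ge0.
  apply/lee_addgt0Pr => e e0; rewrite add0e.
  have p2 : 0 < 2 `^ s :> R by apply: powR_gt0.
  (* Radii are at most d / 2 because diameters are bounded by twice the radius; dividing by 2^s
     absorbs the same factor in the sum. *)
  pose eta n := Num.min (d / 2) (e / (2 ^ n.+1)%:R / 2 `^ s).
  have en0 n : 0 < e / (2 ^ n.+1)%:R by rewrite divr_gt0 // ltr0n expn_gt0.
  have eta0 n : 0 < eta n by rewrite lt_min !divr_gt0 // ltr0n expn_gt0.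
  have /choice [cr hcr] : forall n, exists cr : seq pt * R,
      [/\ 0 < cr.2, cr.2 <= eta n,
        forall p, A n p -> exists2 c, c \in cr.1 & dist1 p c < cr.2 &
        (size cr.1)%:R * cr.2 `^ s <= eta n].
    by move=> n; have [cs [r h]] := cov n _ (eta0 n); exists (cs, r).
  pose cs n := (cr n).1; pose r n := (cr n).2.
  pose G := pair_cover cs r.
  have r0 n : 0 < r n by case: (hcr n).
  have /card_esym/ppcard_eqP [f] := card_nat2.
  pose a (x : nat * nat) : \bar R := (diam (uncurry G x) `^ s)%E.
  have a0 x : (0 <= a x)%E by exact: poweR_ge0.
  apply: (@le_trans _ _ (\esum_(i in setT) a i)).
    apply: ereal_inf_lbound; exists (uncurry G \o f); split.
    - move=> z /BA [n hz].
      have [_ _ hc _] := hcr n; have [c /(nthP (0, 0)) [j jlt <-] hd] := hc _ hz.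
      exists (f^-1%FUN (n, j)) => //=; rewrite invK ?inE //=.
      by rewrite /G /pair_cover jlt.
    - move=> k /=; case: (f k) => n j /=; rewrite /G /pair_cover.
      case: ltnP => _; last by rewrite diam_set0 lee_fin ltW.
      apply: le_trans (diam_ball _ (ltW (r0 n))) _; rewrite lee_fin.
      have [_ le _ _] := hcr n; have : eta n <= d / 2 by rewrite ge_min lexx.
      by rewrite /r; lra.
    - rewrite -(esum_pred_image a _ xpredT) //; last first.
        by move=> x y _ _ /(bij_inj (f := f)); apply.
      congr (esum _ _); apply/seteqP; split=> // y _.
      by exists (f^-1%FUN y) => //; rewrite invK ?inE.
  have -> : \esum_(i in setT) a i =
      \esum_(n in [set: nat]) \esum_(j in [set: nat]) (diam (G n j) `^ s)%E.
    rewrite esum_esum; last by move=> *; exact: poweR_ge0.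
    congr (esum _ _); first by apply/seteqP; split.
    by apply/funext => -[].
  rewrite -nneseries_esumT; last first.
    by move=> n; apply: esum_ge0 => j _; exact: poweR_ge0.
  apply: le_trans (epsilon_trick0 xpredT (ltW e0)).
  apply: lee_nneseries => [n _ _|n _]; first by apply: esum_ge0 => j _; exact: poweR_ge0.
  rewrite -nneseries_esumT; last by move=> j; exact: poweR_ge0.
  apply: le_trans (pair_cover_sum cs s0 (r0 n)) _; rewrite lee_fin.
  have [_ _ _ sz] := hcr n.
  have : eta n <= e / (2 ^ n.+1)%:R / 2 `^ s by rewrite ge_min lexx orbT.
  rewrite ler_pdivlMr // => h; apply: le_trans h.
  rewrite (powRM _ _ (ltW (r0 n))) // mulrCA [leRHS]mulrC.
  by rewrite ler_pM2l.
apply/eqP; rewrite eq_le; apply/andP; split.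
  by apply: ge_ereal_sup => _ [d d0 ->]; rewrite pre0.
by apply: ereal_sup_ubound; exists 1 => //; rewrite pre0.
Qed.

Lemma hausdorff_dim_le (s : R) (B : set (cplane R)) : 0 < s ->
  hausdorff_measure s B = 0%E -> (hausdorff_dim B <= s%:E)%E.
Proof. by move=> s0 h; apply: ereal_inf_lbound; exists s. Qed.

Local Notation leb2 := (@lebesgue_measure R \x @lebesgue_measure R)%E.

Lemma measurable_live (M : R) (C : seq rect) : measurable [set p | live M C p].
Proof.
elim: C => [|c C IH].
  have -> : [set p | live M [::] p] = `[- M, M]%classic `*` `[- M, M]%classic.
    apply/seteqP; split=> p /=.
      by move=> [[h1 h2] _]; rewrite !in_itv /= -!ler_norml.
    by rewrite !in_itv /= -!ler_norml => -[h1 h2]; split.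
  by apply: measurableX; exact: measurable_itv.
have -> : [set p | live M (c :: C) p] = [set p | live M C p] `\`
    (`]c.1.1 - c.2.1, c.1.1 + c.2.1[%classic `*`
     `]c.1.2 - c.2.2, c.1.2 + c.2.2[%classic).
  have opE p : open_rect c p <-> (`]c.1.1 - c.2.1, c.1.1 + c.2.1[%classic `*`
     `]c.1.2 - c.2.2, c.1.2 + c.2.2[%classic) p.
    by rewrite /open_rect /= !in_itv /= !ltr_distl.
  apply/seteqP; split=> p /=.
    move=> [hb hl]; split.
      by split=> // d hd; apply: hl; rewrite in_cons hd orbT.
    by move/opE; apply: hl; rewrite mem_head.
  move=> [[hb hl] no]; split=> // d; rewrite in_cons => /orP [/eqP ->|/hl //].
  by move/opE.
by apply: measurableD => //; apply: measurableX; exact: measurable_itv.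
Qed.

Lemma measure_square (c : pt) (r : R) : 0 < r ->
  leb2 (`[c.1 - r, c.1 + r]%classic `*` `[c.2 - r, c.2 + r]%classic) =
  ((2 * r) ^+ 2)%:E.
Proof.
move=> r0; rewrite product_measure1E; try exact: measurable_itv.
have itvE (x : R) : lebesgue_measure `[x - r, x + r]%classic = (2 * r)%:E.
  rewrite lebesgue_measure_itv /= lte_fin.
  have -> : x - r < x + r by lra.
  by rewrite -EFinB; congr (_%:E); ring.
by rewrite /= !itvE -EFinM expr2.
Qed.

(** Each ball lies in a square of area 4 r^2, and r^2 <= r^s because r <= 1 and s <= 2. *)
Lemma coverable_measure (s eta : R) (B : set pt) : measurable B ->
  s <= 2 -> eta <= 1 -> coverable s eta B -> (leb2 B <= (4 * eta)%:E)%E.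
Proof.
move=> mB s2 eta1 [cs [r [r0 le cov sz]]].
pose Q (c : pt) := `[c.1 - r, c.1 + r]%classic `*` `[c.2 - r, c.2 + r]%classic.
have mQ c : measurable (Q c) by apply: measurableX; exact: measurable_itv.
pose U (l : seq pt) := \big[setU/set0]_(c <- l) Q c.
have mU l : measurable (U l) by apply: bigsetU_measurable.
have Ule l : (leb2 (U l) <= ((size l)%:R * (2 * r) ^+ 2)%:E)%E.
  elim: l => [|c l IH]; first by rewrite /U big_nil measure0 mul0r.
  have sub := measureU2 leb2 (mQ c) (mU l).
  rewrite /U big_cons; apply: (le_trans sub).
  rewrite [size _]/= -nat1r mulrDl mul1r EFinD; apply: leeD; last exact: IH.
  by rewrite le_eqVlt; apply/orP; left; apply/eqP; exact: measure_square.
have BU : B `<=` U cs.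
  move=> p /cov [c hc hd]; rewrite /U -bigcup_seq; exists c => //=.
  have [h1 h2] := dist1_lt_proj hd.
  by rewrite /Q /= !in_itv /= -!ler_distlC ltW // ltW.
apply: (@le_trans _ _ (leb2 (U cs))).
  apply: (@le_measure _ _ _ leb2) BU; rewrite inE; first exact: mB.
  exact: mU.
apply: (le_trans (Ule cs)); rewrite lee_fin.
have : r ^+ 2 <= r `^ s.
  rewrite -(powR_mulrn _ (ltW r0)); apply: ger_powR s2.
  by rewrite r0 (le_trans le).
move=> h.
have : (size cs)%:R * r ^+ 2 <= (size cs)%:R * r `^ s :> R by rewrite ler_wpM2l.
by rewrite exprMn; lra.
Qed.

End Size.

(** * Transfer to the complex plane *)

Section Transfer.
Context {R : realType}.
Notation pt := (R * R)%type.
Notation rect := ((R * R) * (R * R))%type.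

Lemma nbhs_cplane (z : cplane R) (A : set (cplane R)) :
  nbhs z A <-> exists2 r : R, 0 < r &
    forall w, dist1 (plane_of z) (plane_of w) < r -> A w.
Proof.
have normE (w : cplane R) : `|w| = ((Normc.normc w)%:C)%C by [].
split.
  move=> /nbhs_ballP [e /= e0 he].
  (* Radii of balls here are elements of R[i]; positivity in that order forces the imaginary part to
     vanish. *)
  have er : e = ((complex.Re e)%:C)%C.
    by move: e0; rewrite ltcE => /andP [/eqP /= im _]; case: e im {he} => a b /= ->.
  exists (complex.Re e); first by move: e0; rewrite ltcE => /andP [].
  move=> w hw; apply: he; rewrite -ball_normE /= normE er ltcR.
  exact: le_lt_trans (normc_le_dist1 _ _) hw.
move=> [r r0 hr]; apply/nbhs_ballP; exists (((r / 2)%:C)%C).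
  by rewrite /= ltcR; lra.
move=> w; rewrite -ball_normE /= normE ltcR => hw; apply: hr.
have [h1 h2] := proj_le_normc z w.
by rewrite /dist1 /plane_of /=; lra.
Qed.

Lemma continuous_transfer (f : pt -> pt) : uniform1 f ->
  continuous (of_plane \o f \o plane_of : cplane R -> cplane R).
Proof.
move=> uf z A /nbhs_cplane [r r0 hr].
have [d d0 hd] := uf r r0.
by apply/nbhs_cplane; exists d => // w hw; apply: hr; rewrite /= !of_planeK; exact: hd.
Qed.

Lemma continuous_of_plane : continuous (of_plane : pt -> cplane R).
Proof.
move=> [a b] A /nbhs_cplane [r r0 hr].
exists (ball a (r / 2), ball b (r / 2)).
  by split; apply: nbhsx_ballx; lra.
move=> [x y] [/= h1 h2]; apply: hr; rewrite of_planeK /dist1 /=.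
by move: h1 h2; rewrite /ball /=; lra.
Qed.

Lemma closed_complement_ball (K : set (cplane R)) (z : cplane R) : closed K ->
  ~ K z -> exists2 r : R, 0 < r &
    forall w, dist1 (plane_of z) (plane_of w) < r -> ~ K w.
Proof.
move=> cK nK; apply/(nbhs_cplane z (~` K)).
by move: cK => /closed_openC; rewrite openE; apply.
Qed.

Lemma compact_in_box (K : set (cplane R)) : compact K ->
  exists2 M : R, 0 < M & forall z, K z -> in_box M (plane_of z).
Proof.
move=> cK.
pose u (z : cplane R) : R := dist1 (plane_of z) (0, 0).
have cu : continuous u.
  move=> z A /nbhs_ballP [e /= e0 he]; apply/nbhs_cplane; exists e => // w hw.
  apply: he; rewrite /ball /=; apply: le_lt_trans hw; rewrite ler_norml /u.
  have := dist1_triangle (plane_of w) (plane_of z) (0, 0).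
  have := dist1_triangle (plane_of z) (plane_of w) (0, 0).
  by rewrite (dist1C (plane_of w) (plane_of z)) => ? ?; apply/andP; split; lra.
have := compact_bounded (continuous_compact (continuous_subspaceT cu) cK).
move=> [M [_ hM]]; exists (`|M| + 1); first by have := normr_ge0 M; lra.
move=> z Kz; have /hM : M < `|M| + 1 by have := ler_norm M; lra.
move=> /(_ (u z)) h; have /h : (u @` K) (u z) by exists z.
rewrite /u /dist1 /= !subr0 ger0_norm ?addr_ge0 // /in_box /=.
have := normr_ge0 (complex.Re z); have := normr_ge0 (complex.Im z).
by move=> *; split; lra.
Qed.

Lemma empty_interior_dense (K : set (cplane R)) : closed K -> interior K = set0 ->
  dense_balls (fun p (r : R) => forall q : pt, dist1 p q < r -> ~ K (of_plane q)).
Proof.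
move=> cK iK p r r0.
have [q hq nK] : exists2 q : pt, dist1 p q < r & ~ K (of_plane q).
  apply: contrapT => no.
  suff : interior K (of_plane p) by rewrite iK.
  apply/nbhs_cplane; exists r => // w; rewrite of_planeK => hw.
  by apply: contrapT => nw; apply: no; exists (plane_of w); rewrite ?plane_ofK.
have [r' r'0 hr'] := closed_complement_ball cK nK.
exists q, (Num.min r' (r - dist1 p q)).
have le : Num.min r' (r - dist1 p q) <= r - dist1 p q by rewrite ge_min lexx orbT.
split; first by rewrite lt_min r'0 subr_gt0.
  by lra.
move=> q'; rewrite lt_min => /andP [h _]; apply: hr'.
by rewrite !of_planeK.
Qed.

(** Besides openness of the complement this records its two local forms, where the limit map is the
    identity or a similarity. *)
Lemma not_live_ball (M : R) (C : seq rect) p : ~ live M C p ->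
  (exists2 r : R, 0 < r & forall q, dist1 p q < r -> ~ in_box M q) \/
  (exists2 c, c \in C & exists2 r : R, 0 < r &
     forall q, dist1 p q < r -> open_rect c q).
Proof.
move=> nl.
have proj q r : dist1 p q < r -> `|q.1 - p.1| < r /\ `|q.2 - p.2| < r by exact: dist1_lt_proj.
have out (x y : R) : `|x - y| < `|y| - M -> ~ `|x| <= M.
  by move=> h1 h2; have := lerB_dist y x; rewrite distrC; lra.
have [b1|b1] := leP `|p.1| M; last first.
  left; exists (`|p.1| - M); first lra.
  by move=> q /proj [h _] [h1 _]; exact: (out _ _ h) h1.
have [b2|b2] := leP `|p.2| M; last first.
  left; exists (`|p.2| - M); first lra.
  by move=> q /proj [_ h] [_ h1]; exact: (out _ _ h) h1.
right; have [c hc [h1 h2]] : exists2 c, c \in C & open_rect c p.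
  apply: contrapT => no; apply: nl; split=> // c hc op.
  by apply: no; exists c.
exists c => //; exists (Num.min (c.2.1 - `|p.1 - c.1.1|) (c.2.2 - `|p.2 - c.1.2|)).
  by rewrite lt_min !subr_gt0 h1 h2.
move=> q; rewrite lt_min => /andP [/proj [k1 _] /proj [_ k2]].
have := ler_distD p.1 q.1 c.1.1; have := ler_distD p.2 q.2 c.1.2.
by split; lra.
Qed.

(** Near 0 the difference quotient is constantly [l]. *)
Lemma derivable_similarity (f : cplane R -> cplane R) (z a b : cplane R) (l r : R) :
  0 < r -> (forall w, dist1 (plane_of z) (plane_of w) < r ->
    f w = b + (l%:C)%C * (w - a)) -> derivable f z 1.
Proof.
move=> r0 hf; apply/cvg_ex; exists ((l%:C)%C : cplane R).
apply: cvg_near_cst; rewrite /dnbhs nearE /within /=.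
apply/nbhs_cplane; exists r => // h hh h0.
have hz : dist1 (plane_of z) (plane_of (h + z)) < r.
  case: z h hh {hf h0} => [x y] [u v]; rewrite /dist1 /=.
  have e (t w : R) : t - (w + t) = 0 - w by ring.
  by rewrite !e.
have -> : h%:A = h by exact: mulr1.
rewrite (hf _ hz) (hf z) ?dist1xx //.
rewrite -[_ *: _]/(h^-1 * _ : complex.complex R).
by move: (l%:C)%C => k; field.
Qed.

End Transfer.

(** * The residual sets and the main result *)

Section Final.
Context {R : realType}.
Notation pt := (R * R)%type.
Notation rect := ((R * R) * (R * R))%type.

Definition residue (M : R) (D : nat -> seq rect) (p : pt) :=
  forall n, live M (D n) p.

Lemma measurable_residue M D : measurable [set p | residue M D p].
Proof.
have -> : [set p | residue M D p] = \bigcap_n [set p | live M (D n) p].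
  by apply/seteqP; split=> p h n; [move=> _; exact: h | exact: (h n Logic.I)].
by apply: bigcapT_measurable => n; exact: measurable_live.
Qed.

Lemma in_box_image (M : R) (F G : pt -> pt) p : cancel F G ->
  (forall q, ~ in_box M q -> F q = q) -> in_box M (F p) -> in_box M p.
Proof.
by move=> FG out hF; apply: contrapT => no; apply: (no); rewrite -(out p no).
Qed.

(** Applied to [F] and, with the items swapped, to [G], it identifies the image of the source
    residue with the target residue. *)
Lemma residue_image (M : R) (D : nat -> seq (rect * rect)) (F G : pt -> pt) p :
  cancel F G -> cancel G F -> (forall q, ~ in_box M q -> F q = q) ->
  (forall n i, i \in D n -> homothetic F i) ->
  residue M (fun n => map fst (D n)) p -> residue M (fun n => map snd (D n)) (F p).
Proof.
move=> FG GF out hom h n; split.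
  apply: (in_box_image GF) => [q no|]; first by rewrite -[in LHS](out q no) FG.
  by rewrite FG; case: (h n).
move=> _ /mapP [i hi ->] op; have [_ /(_ i.1)] := h n; apply; first exact: map_f.
exact: homothetic_open FG GF (hom n i hi) op.
Qed.

Lemma area_residue (M s : R) (D : nat -> seq rect) : s <= 2 ->
  (forall n, coverable s ((1 / 2) ^+ n) (live M (D n.+1))) ->
  ((@lebesgue_measure R \x @lebesgue_measure R) [set p | residue M D p] = 0)%E.
Proof.
move=> s2 cov; apply/eqP; rewrite eq_le measure_ge0 andbT.
apply/lee_addgt0Pr => e e0; rewrite add0e.
have [|n hn] := @half_pow_small R (e / 4); first lra.
have h1 : (1 / 2 : R) ^+ n <= 1 by exact: (half_pow_le (leq0n n)).
apply: le_trans (coverable_measure (measurable_residue M D) s2 h1 _) _.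
  by apply: coverable_sub (cov n) => p; apply.
by rewrite lee_fin; lra.
Qed.

End Final.

Unset Implicit Arguments.

Theorem proposition1p4 (R : realType) (K : set (cplane R)) :
  compact K -> interior K = set0 ->
  forall eps : R, 0 < eps ->
  exists L : set (cplane R),
    [/\ compact L,
        K `<=` L,
        (hausdorff_dim (L `\` K) <= (1 + eps)%:E)%E &
        exists f : cplane R -> cplane R,
          [/\ homeomorphism f,
              conformal_on (~` L) f,
              (hausdorff_dim (f @` L) <= (1 + eps)%:E)%E &
              area (f @` L) = 0%E]].
Proof.
move=> cK iK eps eps0.
have clK : closed K by apply: compact_closed cK; exact: norm_hausdorff.
have [M M0 KM] := compact_in_box cK.
(* Capping at 2 makes small s-dimensional size imply small area; dimension at most [s] is still at
   most 1 + eps. *)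
pose s := 1 + Num.min eps 1.
have [s1 s2 seps] : [/\ 1 < s, s <= 2 & s <= 1 + eps].
  have m0 : 0 < Num.min eps 1 by rewrite lt_min eps0 ltr01.
  have m1 : Num.min eps 1 <= 1 by rewrite ge_min lexx orbT.
  have m2 : Num.min eps 1 <= eps by rewrite ge_min lexx.
  by rewrite /s; split; lra.
have s0 : 0 < s by lra.
have dim_le (B : set (cplane R)) : hausdorff_measure s B = 0%E ->
    (hausdorff_dim B <= (1 + eps)%:E)%E.
  by move/(hausdorff_dim_le s0)/le_trans; apply; rewrite lee_fin.
have dE := empty_interior_dense clK iK.
have [F [G [D [[FG GF uF uG] out hD subD cov]]]] := planar_limit M0 s1 dE.
pose src := residue M (fun n => map fst (D n)).
pose tgt := residue M (fun n => map snd (D n)).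
pose L : set (cplane R) := [set z | src (plane_of z)].
pose f : cplane R -> cplane R := of_plane \o F \o plane_of.
pose g : cplane R -> cplane R := of_plane \o G \o plane_of.
have fg : cancel f g by move=> z; rewrite /f /g /= of_planeK FG plane_ofK.
have gf : cancel g f by move=> z; rewrite /f /g /= of_planeK GF plane_ofK.
have imL z : (f @` L) z <-> tgt (plane_of z).
  split=> [[w Lw <-]|hz].
    by rewrite /f /= of_planeK; apply: residue_image Lw => // n i /hD [].
  exists (g z); last exact: gf.
  rewrite /L /g /= of_planeK.
  have := @residue_image R M (fun n => map swap_item (D n)) G F (plane_of z) GF FG.
  have E n : map fst (map swap_item (D n)) = map snd (D n) by rewrite -map_comp.
  have E' n : map snd (map swap_item (D n)) = map fst (D n) by rewrite -map_comp.
  move=> h n; rewrite -E'; apply: h => {n}.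
  - by move=> q no; rewrite -[in LHS](out q no) FG.
  - by move=> n _ /mapP [i hi ->]; apply: homothetic_inv FG _; case: (hD n i hi).
  - by move=> n; rewrite E.
have notL z : ~ L z -> exists2 r : R, 0 < r &
    (forall w, dist1 (plane_of z) (plane_of w) < r -> ~ L w) /\
    exists (a b : cplane R) (l : R), forall w,
      dist1 (plane_of z) (plane_of w) < r -> f w = b + (l%:C)%C * (w - a).
  move=> nL; have [n nl] : exists n, ~ live M (map fst (D n)) (plane_of z).
    by apply: contrapT => no; apply: nL => n; apply: contrapT => h; apply: no; exists n.
  have [[r r0 hr]|[c hc [r r0 hr]]] := not_live_ball nl; exists r => //; split.
  - by move=> w /hr no Lw; have [] := Lw 0%N.
  - by exists 0, 0, 1 => w /hr /out e; rewrite /f /= e plane_ofK add0r subr0 mul1r.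
  - by move=> w /hr op Lw; have [_ /(_ c hc)] := Lw n.
  have /mapP [i /hD [[l [l0 _ e El]] _] ci] := hc.
  exists (of_plane i.1.1), (of_plane i.2.1), l => w /hr [h1 h2].
  rewrite /f /= El -?ci; last by split; exact: ltW.
  case: w {h1 h2} => x y; rewrite /of_plane /=.
  by apply/eqP; rewrite eq_complex /=; apply/andP; split; apply/eqP; rewrite ci; ring.
have oL : open (~` L).
  rewrite openE => z /notL [r r0 [h _]]; apply/nbhs_cplane; exists r => //.
have Ebox p : K (of_plane p) -> in_box M p by move=> /KM; rewrite of_planeK.
exists L; split.
- have cQ : compact (of_plane @` (`[- M, M]%classic `*` `[- M, M]%classic)
      : set (cplane R)).
    apply: continuous_compact; first exact/continuous_subspaceT/continuous_of_plane.
    by apply: compact_setX; exact: segment_compact.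
  apply: subclosed_compact cQ _; first by rewrite -[L]setCK; exact: open_closedC.
  move=> z /(_ 0%N) [[h1 h2] _]; exists (plane_of z); last exact: plane_ofK.
  by rewrite /= !in_itv /= -!ler_norml.
- move=> z Kz n; split; first exact: KM.
  (* No source rectangle ever meets [K], so nothing of [K] is removed. *)
  move=> _ /mapP [i /hD [_ hE] ->] [h1 h2]; apply: (hE (plane_of z)).
    by split; exact: ltW.
  by rewrite plane_ofK.
- apply: dim_le.
  (* Since [K] is closed, the points of [L] at distance at least 2^-n from [K] exhaust the
     difference. *)
  pose A n p := src p /\ forall e, K (of_plane e) -> (1 / 2) ^+ n <= dist1 p e.
  apply: (@hausdorff_measure_eq0 _ s A) => //.
    move=> z [Lz nK]; have [r r0 hr] := closed_complement_ball clK nK.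
    have [n hn] := half_pow_small r0; exists n; split=> // e Ke.
    rewrite leNgt; apply/negP => lt.
    by apply: (hr (of_plane e)) => //; rewrite of_planeK; exact: lt_trans hn.
  move=> n eta eta0; have [k hk] := half_pow_small eta0.
  (* A stage beyond [n] still covers points at distance 2^-n from [K], and one beyond [k] covers
     them at scale [eta]. *)
  have [_ c] := cov (maxn n k).
  apply: coverable_le (coverable_sub _ c).
    exact: le_trans (half_pow_le (leq_maxr n k)) (ltW hk).
  move=> p [sp far]; split; first exact: sp.
  by move=> e /far; apply: le_trans; exact: half_pow_le (leq_maxl n k).
exists f; split.
- by split; [exact: continuous_transfer | exists g; split=> //; exact: continuous_transfer].
- split=> //; first by move=> z w _ _; exact: can_inj fg z w.
  by move=> z /notL [r r0 [_ [a [b [l h]]]]]; exact: derivable_similarity r0 h.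
- apply/dim_le/(@hausdorff_measure_eq0 _ s (fun=> tgt)) => //.
    by move=> z /imL; exists 0%N.
  move=> _ eta eta0; have [k hk] := half_pow_small eta0; have [c _] := cov k.
  apply: coverable_le (coverable_sub _ c); first exact: ltW.
  by move=> p; apply.
rewrite /area -[RHS](@area_residue R M s (fun n => map snd (D n)) s2); last first.
  by move=> n; case: (cov n).
congr (_ _); apply/seteqP; split=> p.
  by move=> [z /imL hz <-].
by move=> hp; exists (of_plane p); [apply/imL; rewrite of_planeK | exact: of_planeK].
Qed.
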